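(* Let $q:[0,\infty)\to\mathbb{C}^n$ be continuous. For every $\phi\in C_{cn}$ there exists a unique solution $w=w^{\phi}:[-h,\infty)\to\mathbb{C}^n$ of the inhomogeneous equation $$\frac{d}{dt}(w(t)-Lw_t)=Rw_t+q(t)$$ with $w_0=\phi$. This solution is given by $w^{\phi}=v^{\phi}+p$, that is, $$w^{\phi}(t)=v^{\phi}(t)+\int_{(0,t)}X(t-s)q(s)\,dm(s)\quad\text{for}\quad t>0,$$ where $v^{\phi}$ is the solution of the homogeneous problem ($q=0$) with $v^{\phi}_0=\phi$, $X$ is the fundamental solution, and $p(t)=\int_{(0,t)}X(t-s)q(s)\,dm(s)$ for $t>0$, $p(t)=0$ for $t\le0$.
   Context: Let $n\in\mathbb{N}$, $h>0$, $I=[-h,0]$; $|\cdot|$ is a fixed norm on $\mathbb{C}^n$. $C_c$ is the space of continuous functions $I\to\mathbb{C}$ and $C_{cn}$ the Banach space of continuous maps $I\to\mathbb{C}^n$, with $|\phi|=\max_{t\in I}|\phi(t)|$. For a map $v$ on $M\subset\mathbb{R}$ and $t$ with $[t-h,t]\subset M$, the segment $v_t$ is the map on $I$ given by $v_t(s)=v(t+s)$. A map $w:J\to X$ from an interval $J\subset\mathbb{R}$ into a normed linear space has property (A) if it is the (everywhere) pointwise limit of a sequence of continuous maps $w_m:J\to X$ with $\sup_{m,t}|w_m(t)|<\infty$. $B_{nA}$ is the space of maps $I\to\mathbb{C}^n$ whose components have property (A), normed by $|\phi|=\sup_{t\in I}|\phi(t)|$. $L_c(X,Y)$ is the space of continuous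 linear maps with the operator norm, $X^{\ast}=L_c(X,\mathbb{C})$, and $\iota:X\to X^{\ast\ast}$, $\iota(x)x^{\ast}=x^{\ast}x$. Extensions. For $\lambda\in C_{cn}^{\ast}$ and $k=1,\dots,n$ let $E_k:C_c\to C_{cn}$ be the embedding into the $k$-th component, and let $\mu_k$ be the unique complex Borel measure on $I$ with $|\mu_k|$ regular and $\lambda(E_k\chi)=\int\chi\,d\mu_k$ for all $\chi\in C_c$ (Riesz). Set $\lambda_e\phi=\sum_{k=1}^n\int\phi_k\,d\mu_k$ for bounded Borel $\phi:I\to\mathbb{C}^n$. For a normed linear space $Y$ over $\mathbb{C}$ and $\Lambda\in L_c(C_{cn},Y)$, $\Lambda_E:B_{nA}\to Y^{\ast\ast}$ is given by $(\Lambda_E\phi)y^{\ast}=(y^{\ast}\circ\Lambda)_e\phi$. Weak-star integral. $m$ is Lebesgue measure on $\mathbb{R}$. For an interval $J$ and $F:J\to Y^{\ast\ast}$, $\int_JF\,dm$ exists if $t\mapsto F(t)y^{\ast}$ is Lebesgue-integrable on $J$ for every $y^{\ast}\in Y^{\ast}$; then $\left(\int_JF\,dm\right)y^{\ast}=\int_JF(t)y^{\ast}\,dm(t)$. Standing assumption: $L,R\in L_c(C_{cn},\mathbb{C}^n)$, and ($\Delta$): there is $\Delta\in(0,h)$ with $L\phi=0$ for all $\phi\in C_{cn}$ with $\phi(t)=0$ on $[-h,-\Delta]$. Solutions. A solution of $\frac{d}{dt}(v(t)-Lv_t)=Rv_t+q(t)$ is a continuous map $v:[-h,\infty)\to\mathbb{C}^n$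 such that $[0,\infty)\ni t\mapsto v(t)-Lv_t\in\mathbb{C}^n$ is differentiable and satisfies the equation for all $t\ge0$ (right derivative at $t=0$). For $q=0$ each $\phi\in C_{cn}$ uniquely determines a solution $v^{\phi}$ with $v^{\phi}_0=\phi$. Fundamental solution. For each $\phi\in B_{nA}$ there is a unique map $y=y^{\phi}:[-h,\infty)\to\mathbb{C}^n$ with $y_0=\phi$ such that all restrictions of $y$ to compact intervals and all segments $y_s$, $s\ge0$, have property (A), all weak-star integrals $\int_{(0,t)}R_Ey_s\,dm(s)$, $t>0$, exist, and $\iota(y(t))-L_Ey_t=\iota(\phi(0))-L_E\phi+\int_{(0,t)}R_Ey_s\,dm(s)$ for all $t>0$. For $j\in\{1,\dots,n\}$ let $\phi_j:I\to\mathbb{C}^n$, $\phi_j(t)=0$ on $[-h,0)$ and $\phi_j(0)=e_j$ (standard basis vector). $X_j:\mathbb{R}\to\mathbb{C}^n$ is defined by $X_j(t)=0$ for $t<0$ and $X_j(t)=y^{\phi_j}(t)$ for $t\ge0$, and the fundamental solution $X:\mathbb{R}\to\mathbb{C}^{n\times n}$ has columns $X_1,\dots,X_n$, so $X(t)z=\sum_jz_jX_j(t)$. Integrals of $\mathbb{C}^n$-valued maps are taken componentwise. *)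

(* Defs.v *)
From HB Require Import structures.
From mathcomp Require Import all_boot all_order all_algebra.
From mathcomp Require Import all_classical all_reals all_analysis.
From mathcomp Require Import complex.

Set Implicit Arguments.
Unset Strict Implicit.
Unset Printing Implicit Defensive.

Import Order.TTheory GRing.Theory Num.Theory numFieldNormedType.Exports.

Local Open Scope classical_set_scope.
Local Open Scope complex_scope.
Local Open Scope ring_scope.

Record cnorm (R : realType) (n : nat) := CNorm {
  cnorm_fun :> 'cV[R[i]]_n -> R ;
  cnormD : forall x y, cnorm_fun (x + y) <= cnorm_fun x + cnorm_fun y ;
  cnormZ : forall (a : R[i]) x,
    cnorm_fun (a *: x) = complex.Re `|a| * cnorm_fun x ;
  cnorm0_eq0 : forall x, cnorm_fun x = 0 -> x = 0 }.

(* An alias of 'cV[R[i]]_n, so that its norm and topology come from [N] and not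
   from the library's max norm on matrices. *)
Definition Cn (R : realType) (n : nat) (N : cnorm R n) : Type := 'cV[R[i]]_n.

Section Cn_normed.
Context {R : realType} {n : nat} (N : cnorm R n).

HB.instance Definition _ := GRing.Lmodule.copy (Cn N) 'cV[R[i]]_n.

Let nrm (x : Cn N) : R[i] := (N x)%:C.

Let nrmD (x y : Cn N) : nrm (x + y) <= nrm x + nrm y.
Proof. by rewrite /nrm -rmorphD lecR cnormD. Qed.

Let nrmZ (a : R[i]) (x : Cn N) : nrm (a *: x) = `|a| * nrm x.
Proof.
by rewrite /nrm cnormZ rmorphM/=; congr (_ * _); apply/RRe_real/normr_real.
Qed.

Let nrm0 (x : Cn N) : nrm x = 0 -> x = 0.
Proof. by move=> [] /cnorm0_eq0. Qed.

HB.instance Definition _ :=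
  @Lmodule_isNormed.Build R[i] (Cn N) nrm nrmD nrmZ nrm0.

End Cn_normed.

Definition itvI (R : realType) (h : {posnum R}) : Type :=
  set_type `[- h%:num, 0]%classic.

Section itvI_instances.
Context {R : realType} (h : {posnum R}).

HB.instance Definition _ :=
  PseudoMetric.copy (itvI h) (set_type `[- h%:num, 0]%classic).

Lemma itvI_0 : 0 \in `[- h%:num, 0]%classic.
Proof. by apply/mem_set; rewrite /= in_itv/= lexx oppr_le0 andbT. Qed.

Definition I0 : itvI h := exist _ 0 itvI_0.

HB.instance Definition _ := isPointed.Build (itvI h) I0.

End itvI_instances.

Definition valI (R : realType) (h : {posnum R}) (s : itvI h) : R := set_val s.

Definition cts_pred (R : realType) (h : {posnum R}) (V : normedModType R[i]) :
  {pred itvI h -> V} := fun phi => `[< continuous phi >].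

Record contI (R : realType) (h : {posnum R}) (V : normedModType R[i]) := ContI {
  contI_fun :> itvI h -> V ;
  contI_cts : contI_fun \in @cts_pred R h V }.

(* The library's norms over the field R[i] are R[i]-valued; [rnorm] is the same
   norm as an element of R. *)
Definition rnorm (R : realType) (V : normedModType R[i]) (x : V) : R :=
  complex.Re `|x|.

Lemma rnormE (R : realType) (V : normedModType R[i]) (x : V) :
  `|x| = (rnorm x)%:C.
Proof. by apply/esym/RRe_real/normr_real. Qed.

Section contI_normed.
Context {R : realType} {h : {posnum R}} {V : normedModType R[i]}.
Local Notation contI := (contI h V).

HB.instance Definition _ := [isSub for @contI_fun R h V].
HB.instance Definition _ := [Choice of contI by <:].

Lemma cts_predP (phi : itvI h -> V) :
  reflect (continuous phi) (phi \in @cts_pred R h V).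
Proof. exact: asboolP. Qed.

Lemma cts_submod : submod_closed (@cts_pred R h V).
Proof.
split; first exact/cts_predP/cst_continuous.
move=> a f g /cts_predP cf /cts_predP cg; apply/cts_predP => x.
apply: (cvgD (cvgZl_tmp (cf x)) (cg x)).
Qed.

HB.instance Definition _ :=
  GRing.isSubmodClosed.Build _ _ (@cts_pred R h V) cts_submod.
HB.instance Definition _ := [SubChoice_isSubLmodule of contI by <:].

(* The supremum is a maximum, by compactness of I. *)
Definition contI_norm (phi : contI) : R := sup (range (fun t => rnorm (phi t))).

Lemma rnorm_continuous (phi : contI) : continuous (fun t => rnorm (phi t)).
Proof.
have /cts_predP cphi := contI_cts phi.
move=> t; have F : Filter (nbhs t) by exact: nbhs_filter.
apply/(@cvgrPdist_lt _ _ _ (nbhs t) F) => e e0.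
have e0' : 0 < e%:C by rewrite ltcR.
have /(@cvgrPdist_lt _ _ _ (nbhs t) F)/(_ _ e0') := cphi t.
apply: filterS => s H; rewrite -ltcR.
apply: le_lt_trans H; apply: le_trans (ler_dist_dist _ _).
by rewrite !rnormE -rmorphB/= normc_def/= expr0n/= addr0 sqrtr_sqr lecR.
Qed.

Lemma rnorm_has_ubound (phi : contI) : has_ubound (range (fun t => rnorm (phi t))).
Proof.
pose f t := rnorm (phi t).
have cf : {within `[- h%:num, 0], continuous (valL f)}.
  by apply/subspace_valL_continuousP; exact: rnorm_continuous.
have /compact_bounded[M [_ /(_ (M + 1))]] :=
  continuous_compact cf (@segment_compact R (- h%:num) 0).
rewrite ltrDl ltr01 => /(_ isT) bM.
exists (M + 1) => _ [t _ <-]; apply: le_trans (ler_norm _) _.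
apply: bM; exists (set_val t); first exact/set_valP.
by rewrite -[RHS]/(f t) -{2}(@valLK _ _ point _ f).
Qed.

Lemma rnorm_le (phi : contI) t : rnorm (phi t) <= contI_norm phi.
Proof.
by apply: ub_le_sup; [exact: rnorm_has_ubound | exists t].
Qed.

Lemma contI_norm_le (phi : contI) M : 0 <= M ->
  (forall t, rnorm (phi t) <= M) -> contI_norm phi <= M.
Proof.
move=> M0 phiM; rewrite /contI_norm.
have [->|/set0P rne] := eqVneq (range (fun t => rnorm (phi t))) set0.
  by rewrite sup0.
by apply: ge_sup => // _ [t _ <-]; exact: phiM.
Qed.

Lemma rnorm_ge0 (x : V) : 0 <= rnorm x.
Proof. by rewrite -lecR -rnormE normr_ge0. Qed.

Lemma contI_norm_ge0 (phi : contI) : 0 <= contI_norm phi.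
Proof.
rewrite /contI_norm.
have [->|/set0P[_ [t _ _]]] := eqVneq (range (fun t => rnorm (phi t))) set0.
  by rewrite sup0.
exact: le_trans (rnorm_ge0 (phi t)) (rnorm_le _ _).
Qed.

Let nrm (phi : contI) : R[i] := (contI_norm phi)%:C.

Let nrmD (phi psi : contI) : nrm (phi + psi) <= nrm phi + nrm psi.
Proof.
rewrite /nrm -rmorphD lecR; apply: contI_norm_le => [|t].
  by rewrite addr_ge0 ?contI_norm_ge0.
apply: (@le_trans _ _ (rnorm (phi t) + rnorm (psi t))).
  by rewrite -lecR rmorphD/= -!rnormE ler_normD.
by rewrite lerD ?rnorm_le.
Qed.

Let cnormE (a : R[i]) : {b : R | 0 <= b & `|a| = b%:C}.
Proof.
have aE : `|a| = (complex.Re `|a|)%:C by exact/esym/RRe_real/normr_real.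
by exists (complex.Re `|a|) => //; rewrite -lecR -aE normr_ge0.
Qed.

Let nrmZ_le (a : R[i]) (phi : contI) b : `|a| = b%:C -> 0 <= b ->
  contI_norm (a *: phi) <= b * contI_norm phi.
Proof.
move=> aE b0; apply: contI_norm_le => [|t].
  by rewrite mulr_ge0 ?contI_norm_ge0.
rewrite /rnorm normrZ aE [`|phi t|]rnormE -rmorphM/=.
by rewrite ler_wpM2l// rnorm_le.
Qed.

Let nrmZ (a : R[i]) (phi : contI) : nrm (a *: phi) = `|a| * nrm phi.
Proof.
have [b b0 aE] := cnormE a; have [c c0 aVE] := cnormE a^-1.
transitivity ((b * contI_norm phi)%:C); last by rewrite rmorphM/= -aE.
congr (_%:C); apply/eqP; rewrite eq_le (nrmZ_le _ aE)//=.
have [a0|aN0] := eqVneq a 0.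
  have -> : b = 0 by apply: complexI; rewrite -aE a0; exact: normr0.
  by rewrite mul0r contI_norm_ge0.
have bc : b * c = 1.
  apply: complexI; rewrite rmorphM/= -aE -aVE.
  by have := congr1 Num.norm (mulfV aN0); rewrite normrM => ->; exact: normr1.
rewrite -[leRHS]mul1r -bc -mulrA ler_wpM2l//.
by rewrite -{1}(scalerK aN0 phi) nrmZ_le.
Qed.

Let nrm0 (phi : contI) : nrm phi = 0 -> phi = 0.
Proof.
move=> [] phi0; apply/val_inj/funext => t /=.
apply/normr0_eq0; rewrite rnormE; congr (_%:C); apply/eqP.
by rewrite eq_le rnorm_ge0 andbT -phi0 rnorm_le.
Qed.

HB.instance Definition _ :=
  @Lmodule_isNormed.Build R[i] contI nrm nrmD nrmZ nrm0.

End contI_normed.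

Section Lc.
Context {R : realType}.

Record Lc (X Y : normedModType R[i]) := MkLc {
  Lc_fun :> {linear X -> Y} ;
  Lc_cts : continuous Lc_fun }.

Definition Lc_comp (X Y Z : normedModType R[i]) (g : Lc Y Z) (f : Lc X Y) :
    Lc X Z.
Proof.
apply: (@MkLc _ _ (g \o f : {linear X -> Z})) => x.
by apply: continuous_comp; exact: Lc_cts.
Defined.

Definition dual (Y : normedModType R[i]) := Lc Y (R[i])^o.

(* Y** is regarded inside the space of all scalar functions on Y*, so that
   equality in Y** is equality at every ystar. *)
Definition iota (Y : normedModType R[i]) (y : Y) : dual Y -> R[i] :=
  fun ystar => ystar y.

End Lc.

Section integrals.
Context d (T : measurableType d) (R : realType).
Implicit Types (mu : {measure set T -> \bar R}) (D : set T) (f : T -> R[i]).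

Definition cintegrable mu D f :=
  mu.-integrable D (EFin \o (fun t => complex.Re (f t))) /\
  mu.-integrable D (EFin \o (fun t => complex.Im (f t))).

Definition cintegral mu D f : R[i] :=
  (Rintegral mu D (fun t => complex.Re (f t)))
  +i* (Rintegral mu D (fun t => complex.Im (f t))).

Definition hahn (nu : {charge set T -> \bar R}) :
  {PN : set T * set T | hahn_decomposition nu PN.1 PN.2}.
Proof.
apply: cid; have [P [N PN]] := Hahn_decomposition nu.
by exists (P, N).
Defined.

(* Integral with respect to a finite signed measure, by its Jordan
   decomposition (which does not depend on the Hahn decomposition). *)
Definition charge_integral (nu : {charge set T -> \bar R}) (f : T -> R) : R :=
  Rintegral (jordan_pos (projT2 (hahn nu))) setT f
  - Rintegral (jordan_neg (projT2 (hahn nu))) setT f.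

Record complex_measure := ComplexMeasure {
  cm_re : {charge set T -> \bar R} ;
  cm_im : {charge set T -> \bar R} }.

Definition cm_val (mu : complex_measure) (A : set T) : R[i] :=
  fine (cm_re mu A) +i* fine (cm_im mu A).

Definition cm_integral (mu : complex_measure) f : R[i] :=
  (charge_integral (cm_re mu) (fun t => complex.Re (f t))
   - charge_integral (cm_im mu) (fun t => complex.Im (f t)))
  +i* (charge_integral (cm_re mu) (fun t => complex.Im (f t))
       + charge_integral (cm_im mu) (fun t => complex.Re (f t))).

Definition cm_variation (mu : complex_measure) (A : set T) : \bar R :=
  ereal_sup [set x | exists F : (set T)^nat,
    [/\ forall i, measurable (F i), trivIset setT F, \bigcup_i F i = A &
        x = (\sum_(0 <= i <oo) (complex.Re `|cm_val mu (F i)|)%:E)%E]].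

End integrals.

Definition vintegrable d (T : measurableType d) (R : realType) (n : nat)
    (mu : {measure set T -> \bar R}) (D : set T) (f : T -> 'cV[R[i]]_n) :=
  forall k, cintegrable mu D (fun t => f t k 0).

Definition vintegral d (T : measurableType d) (R : realType) (n : nat)
    (mu : {measure set T -> \bar R}) (D : set T) (f : T -> 'cV[R[i]]_n) :
    'cV[R[i]]_n :=
  \col_k cintegral mu D (fun t => f t k 0).

Section weak_star.
Context (R : realType) (Y : normedModType R[i]).
Implicit Types (J : set R) (F : R -> dual Y -> R[i]).

Definition ws_integrable J F :=
  forall ystar, cintegrable lebesgue_measure J (fun t => F t ystar).

Definition ws_integral J F : dual Y -> R[i] :=
  fun ystar => cintegral lebesgue_measure J (fun t => F t ystar).

End weak_star.

Definition property_A (R : realType) (T : topologicalType)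
    (X : normedModType R[i]) (w : T -> X) :=
  exists wm : nat -> T -> X,
    [/\ forall m, continuous (wm m),
        exists M : R, forall m t, rnorm (wm m t) <= M &
        forall t, wm m t @[m --> \oo] --> w t].

Section extension.
Context {R : realType} {n : nat} {N : cnorm R n} {h : {posnum R}}.
Local Notation C := (R[i])^o.
Local Notation Cn := (Cn N).
Local Notation I := (itvI h).
Local Notation C_c := (contI h C).
Local Notation C_cn := (contI h Cn).

Definition B_nA (phi : I -> Cn) :=
  forall k : 'I_n, property_A (fun t => phi t k 0 : C).

Local Notation borelI := (g_sigma_algebraType (@open I)).

Definition cm_regular (mu : complex_measure borelI R) :=
  forall A : set borelI, measurable A ->
    cm_variation mu A =
      ereal_inf [set cm_variation mu U | U in [set U | open (U : set I) /\ A `<=` U]]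
    /\
    cm_variation mu A =
      ereal_sup [set cm_variation mu K | K in [set K | compact (K : set I) /\ K `<=` A]].

Definition embed_fun (k : 'I_n) (chi : C_c) : I -> Cn :=
  fun t => chi t *: (delta_mx k 0 : Cn).

Lemma embed_cts k chi : embed_fun k chi \in @cts_pred R h Cn.
Proof.
have /cts_predP cchi := contI_cts chi.
by apply/cts_predP => t; exact: (cvgZr_tmp (cchi t)).
Qed.

Definition embed (k : 'I_n) (chi : C_c) : C_cn := ContI (embed_cts k chi).

Definition riesz_measures (lambda : dual C_cn)
    (mu : 'I_n -> complex_measure borelI R) :=
  forall k, cm_regular (mu k) /\
    forall chi : C_c, lambda (embed k chi) = cm_integral (mu k) chi.

(* The extension lambda_e, in terms of the Riesz measures mu of lambda; it is
   meaningful for bounded Borel phi. *)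
Definition lambda_e (mu : 'I_n -> complex_measure borelI R) (phi : I -> Cn) :
    R[i] :=
  \sum_(k < n) cm_integral (mu k) (fun t => phi t k 0).

(* [LambdaE] is the extension Lambda_E : B_nA -> Y** of Lambda; by uniqueness of
   the Riesz measures this determines it on B_nA. *)
Definition is_extension (Y : normedModType R[i]) (Lambda : Lc C_cn Y)
    (LambdaE : (I -> Cn) -> dual Y -> R[i]) :=
  forall ystar : dual Y, exists2 mu,
    riesz_measures (Lc_comp ystar Lambda) mu &
    forall phi, B_nA phi -> LambdaE phi ystar = lambda_e mu phi.

(* Maps on [-h, +oo[ are represented by maps on R of which only the values on
   [-h, +oo[ matter. *)
Definition seg (v : R -> Cn) (t : R) : I -> Cn := fun s => v (t + valI s).

(* The segment as an element of C_cn; the default 0 is only taken if the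
   segment is not continuous. *)
Definition cseg (v : R -> Cn) (t : R) : C_cn := insubd 0 (seg v t).

Definition has_initial (v : R -> Cn) (phi : I -> Cn) :=
  forall s : I, v (valI s) = phi s.

Definition Delta_cond (L : Lc C_cn Cn) :=
  exists2 Delta : R, 0 < Delta < h%:num &
    forall phi : C_cn, (forall t : I, valI t <= - Delta -> phi t = 0) ->
      L phi = 0.

(* Derivative at t of a map on [0, +oo[; it is one-sided at 0. *)
Definition has_deriv (f : R -> Cn) (t : R) (l : Cn) :=
  (r^-1)%:C *: (f (t + r) - f t) @[r --> within [set r | 0 <= t + r] 0^']
    --> l.

Definition solution (L Rop : Lc C_cn Cn) (q v : R -> Cn) :=
  {within `[- h%:num, +oo[, continuous v} /\
  forall t, 0 <= t ->
    has_deriv (fun t => v t - L (cseg v t)) t (Rop (cseg v t) + q t).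

Definition extended_solution (L Rop : Lc C_cn Cn)
    (phi : I -> Cn) (y : R -> Cn) :=
  exists LE RE, [/\ is_extension L LE, is_extension Rop RE &
  [/\ has_initial y phi,
      forall a b, - h%:num <= a -> a <= b ->
        property_A (fun t : set_type `[a, b]%classic => y (set_val t)),
      forall s, 0 <= s -> property_A (seg y s),
      forall t, 0 < t -> ws_integrable `]0, t[ (fun s => RE (seg y s)) &
      forall t, 0 < t -> forall ystar,
        iota (y t) ystar - LE (seg y t) ystar
        = iota (phi (I0 h)) ystar - LE phi ystar
          + ws_integral `]0, t[ (fun s => RE (seg y s)) ystar]].

Definition phi_ (j : 'I_n) : I -> Cn :=
  fun t => if valI t == 0 then delta_mx j 0 else 0.

Definition fundamental_solution (L Rop : Lc C_cn Cn) (X : R -> 'M[R[i]]_n) :=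
  forall j, exists2 y, extended_solution L Rop (phi_ j) y &
    forall t, col j (X t) = if t < 0 then 0 else y t.

Definition p_fun (X : R -> 'M[R[i]]_n) (q : R -> Cn) (t : R) : Cn :=
  if 0 < t then
    vintegral lebesgue_measure `]0, t[ (fun s => X (t - s) *m q s)
  else 0.

End extension.

(* Main.v *)
(* A continuous v solves the equation iff v(t) - L v_t is a primitive of
   R v_t + q(t).  By the delay condition the term L v_t only sees v up to time
   t - Delta, so in the norm weighted by exp(- g t), g large, the corresponding
   fixed-point map is a contraction; this gives uniqueness, and Picard iteration
   gives existence.

   For the representation it suffices, by uniqueness and linearity, to treat a
   real continuous scalar q and one column x of X, and to show that the
   convolution p of q and x solves the equation with forcing q e_j.  Writing a
   functional of L p_t through its Riesz measures, Fubini gives that L p_t is the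
   convolution of q with s |-> L_E x_s, and likewise for R.  The integral
   equation for x therefore turns p(t) - L p_t into the convolution of q with
   e_j + int_0^s R_E x_r dr, which a second use of Fubini identifies with the
   integral over (0, t) of q(r) e_j + R p_r. *)
From HB Require Import structures.
Require Import Defs.
From mathcomp Require Import all_boot all_order all_algebra.
From mathcomp Require Import all_classical all_reals all_analysis.
From mathcomp Require Import measurable_realfun complex.
From mathcomp Require Import ring lra.

Import Order.TTheory GRing.Theory Num.Theory numFieldNormedType.Exports.

Local Open Scope classical_set_scope.
Local Open Scope complex_scope.
Local Open Scope ring_scope.

Set Implicit Arguments.
Unset Strict Implicit.
Unset Printing Implicit Defensive.

(** * Norm equivalence and coordinates *)

(** The fundamental solution is only a bounded pointwise limit of continuous maps on compact
    intervals, and its equation holds for the extended functionals in the weak-star sense, so it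
    cannot be differentiated directly. Convolution with a continuous [q] restores continuity,
    because a reflection moves the parameter into [q]; after that [L] and [Rop] act on genuine
    continuous segments. Condition [Delta_cond] enters a second time here: it makes the extension of
    [L] vanish at [phi_ j]. Otherwise the forcing obtained from the column would be [q] times e_j
    minus that value. Two matters of representation shape the details. Maps on half-lines are total
    functions with arbitrary values elsewhere, hence the retractions [clamp], [projI] and
    [proj_itv]. Fubini is applied to bounded measurable functions and sets of finite measure, hence
    for each fixed [t] the column and [q] are replaced by bounded functions that agree with them on
    [[0, t]]. The norm on C^n is arbitrary while integrals are componentwise; norm equivalence joins
    the two. *)

Section real_norm.
Context {R : realType} {V : normedModType R[i]}.
Implicit Types (x y : V).

Lemma ge0_complexE (e : R[i]) : 0 < e -> exists2 d : R, 0 < d & e = d%:C.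
Proof.
case: e => a b; rewrite ltcE/= => /andP[/eqP b0 a0].
by exists a => //; rewrite b0.
Qed.

Lemma rnorm0 : rnorm (0 : V) = 0.
Proof. by rewrite /rnorm normr0. Qed.

Lemma rnorm0_eq0 x : rnorm x = 0 -> x = 0.
Proof. by move=> x0; apply/normr0_eq0; rewrite rnormE x0. Qed.

Lemma rnormN x : rnorm (- x) = rnorm x.
Proof. by rewrite /rnorm normrN. Qed.

Lemma rnormD x y : rnorm (x + y) <= rnorm x + rnorm y.
Proof. by rewrite -lecR rmorphD/= -!rnormE ler_normD. Qed.

Lemma rnorm_dist_trans y x z : rnorm (x - z) <= rnorm (x - y) + rnorm (y - z).
Proof. by rewrite -[x - z](subrKA y) rnormD. Qed.

Lemma rnorm_dist x y : `|rnorm x - rnorm y| <= rnorm (x - y).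
Proof.
have H (u v : V) : rnorm u - rnorm v <= rnorm (u - v).
  by rewrite lerBlDr; have := rnormD (u - v) v; rewrite subrK.
by rewrite ler_norml lerNl opprB H -[rnorm (x - y)]rnormN opprB H.
Qed.

Lemma rnormZ (a : R) x : rnorm (a%:C *: x) = `|a| * rnorm x.
Proof.
apply: complexI; rewrite -rnormE normrZ rmorphM/= -rnormE; congr (_ * _).
by rewrite normc_def/= expr0n/= addr0 sqrtr_sqr.
Qed.

Lemma cvg_rnormP {T : Type} (F : set_system T) (FF : Filter F) (f : T -> V) (l : V) :
  f @ F --> l <-> forall e : R, 0 < e -> \forall x \near F, rnorm (l - f x) < e.
Proof.
split=> [/cvgrPdist_lt fl e e0|fl].
  have e0' : 0 < e%:C by rewrite ltcR.
  by apply: filterS (fl _ e0') => x; rewrite rnormE ltcR.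
apply/cvgrPdist_lt => _ /ge0_complexE[e e0 ->].
by apply: filterS (fl _ e0) => x; rewrite rnormE ltcR.
Qed.

End real_norm.

(** Continuity at 0 gives a ball of radius [d] mapped into the unit ball; scaling [x] to norm
    [d / 2] yields the constant [2 / d]. *)
Lemma Lc_bounded (R : realType) (V W : normedModType R[i]) (f : Lc V W) :
  exists2 C, 0 < C & forall x, rnorm (f x) <= C * rnorm x.
Proof.
have /(cvg_rnormP (nbhs_filter _))/(_ _ ltr01) : f x @[x --> (0 : V)] --> f 0.
  exact: Lc_cts.
move=> /nbhs_ballP[_ /ge0_complexE[d d0 ->] /= fd].
exists (2 / d) => [|x]; first by rewrite divr_gt0.
have [x0|x0] := eqVneq (rnorm x) 0.
  by rewrite x0 mulr0 (rnorm0_eq0 x0) linear0 rnorm0.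
have x_gt0 : 0 < rnorm x by rewrite lt_neqAle eq_sym x0 rnorm_ge0.
pose a := d / 2 / rnorm x.
have a0 : 0 < a by rewrite !divr_gt0.
have := fd (a%:C *: x); rewrite /= -ball_normE /= sub0r normrN rnormE ltcR rnormZ.
rewrite (gtr0_norm a0) /a divfK// linear0 sub0r rnormN linearZ/= rnormZ.
rewrite (gtr0_norm a0) => /(_ _)/ltW fx.
rewrite -(ler_pM2l a0); apply: (le_trans (fx _)); first by lra.
rewrite /a le_eqVlt; apply/orP; left; apply/eqP; field.
by apply/andP; split=> //; exact: lt0r_neq0.
Qed.

Lemma rV_entry_le (R : realType) m (r : 'rV[R]_m) i : `|r 0 i| <= `|r|.
Proof.
rewrite [leRHS]/Num.norm/= mx_normrE.
by apply/bigmax_geP; right; exists (0, i).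
Qed.

Section coordinates.
Context {R : realType} {n : nat} {N : cnorm R n}.
Local Notation Cn := (Cn N).
Local Notation ix := ('I_n * bool)%type.

(** Complex integrals are defined through real and imaginary parts, so C^n is handled through its 2n
    real coordinates; the Boolean [true] selects the imaginary part. *)
Definition crd (c : ix) (x : Cn) : R :=
  if c.2 then complex.Im (x c.1 0) else complex.Re (x c.1 0).

Lemma crdD c x y : crd c (x + y) = crd c x + crd c y.
Proof. by rewrite /crd mxE; case: c.2; rewrite raddfD. Qed.

Lemma crdN c x : crd c (- x) = - crd c x.
Proof. by rewrite /crd mxE; case: c.2; rewrite raddfN. Qed.

Lemma crdB c x y : crd c (x - y) = crd c x - crd c y.
Proof. by rewrite crdD crdN. Qed.

Lemma crd0 c : crd c 0 = 0.
Proof. by rewrite /crd mxE; case: c.2. Qed.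

Lemma crdZ c (a : R) x : crd c (a%:C *: x) = a * crd c x.
Proof.
by rewrite /crd mxE; case: (x _ _) => u v; case: c.2 => /=; simpc.
Qed.

Lemma crd_inj x y : (forall c, crd c x = crd c y) -> x = y.
Proof.
move=> xy; apply/matrixP => k l; rewrite (ord1 l).
by apply/eqP; rewrite eq_complex; apply/andP; split; apply/eqP;
  [exact: (xy (k, false))|exact: (xy (k, true))].
Qed.

Definition of_crd (r : ix -> R) : Cn := \col_k (r (k, false) +i* r (k, true)).

Lemma crd_of (r : ix -> R) c : crd c (of_crd r) = r c.
Proof. by rewrite /crd /of_crd mxE; case: c => k []. Qed.

Lemma crd_sum (x : Cn) :
  x = \sum_k ((crd (k, false) x)%:C *: (delta_mx k 0 : Cn) +
    'i *: ((crd (k, true) x)%:C *: (delta_mx k 0 : Cn))).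
Proof.
rewrite {1}(matrix_sum_delta (x : 'cV_n)); apply: eq_bigr => k _.
rewrite big_ord1 scalerA -scalerDl; congr (_ *: _).
by rewrite /crd/=; case: (x k 0) => u v; simpc.
Qed.

(** The triangle inequality over the standard basis gives the sum of the basis norms as constant; 1
    is added to keep it positive also for n = 0. *)
Lemma rnorm_le_crd : exists2 A, 0 < A &
  forall x : Cn, rnorm x <= A * \sum_c `|crd c x|.
Proof.
pose M := \sum_k (rnorm (delta_mx k 0 : Cn)).
have M0 : 0 <= M by apply: sumr_ge0 => k _; exact: rnorm_ge0.
exists (M + 1) => [|x]; first by lra.
rewrite {1}(crd_sum x).
apply: (@le_trans _ _ (\sum_k ((`|crd (k, false) x| + `|crd (k, true) x|)
    * rnorm (delta_mx k 0 : Cn)))).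
  elim/big_ind2 : _ => [|a b c d ab cd|k _]; first by rewrite rnorm0.
    exact: le_trans (rnormD _ _) (lerD ab cd).
  rewrite mulrDl; apply: le_trans (rnormD _ _) _.
  rewrite rnormZ lerD// -lecR -rnormE normrZ normCi mul1r rnormE lecR.
  by rewrite rnormZ.
have -> : \sum_c `|crd c x| = \sum_k (`|crd (k, false) x| + `|crd (k, true) x|).
  rewrite (eq_bigr (fun c => `|crd (c.1, c.2) x|)); last by case.
  rewrite -(pair_bigA _ (fun k b => `|crd (k, b) x|))/=.
  by apply: eq_bigr => k _; rewrite big_bool addrC.
rewrite mulr_sumr; apply: ler_sum => k _.
rewrite mulrC ler_wpM2r ?addr_ge0// /M (bigD1 k)//= -addrA.
by rewrite lerDl addr_ge0// sumr_ge0// => i _; exact: rnorm_ge0.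
Qed.

(** On the compact max-norm unit sphere of real 2n-space the norm is continuous and nonzero, so it
    has a positive minimum [e] there; homogeneity gives the constant [e^-1]. *)
Lemma crd_le_rnorm : exists2 B, 0 < B &
  forall c (x : Cn), `|crd c x| <= B * rnorm x.
Proof.
have [A A0 hA] := rnorm_le_crd.
pose tox (r : 'rV[R]_(n + n)) : Cn :=
  of_crd (fun c => r 0 (if c.2 then rshift n c.1 else lshift n c.1)).
pose f r := rnorm (tox r).
have toxB r s : tox (r - s) = tox r - tox s.
  by apply: crd_inj => c; rewrite crdB !crd_of !mxE.
pose K := A * #|{: ix}|%:R + 1.
have K0 : 0 < K by rewrite ltr_wpDl// mulr_ge0// ltW.
have f_le r : f r <= K * `|r|.
  apply: le_trans (hA _) _; apply: (@le_trans _ _ (A * (#|{: ix}|%:R * `|r|))).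
    rewrite ler_pM2l//; apply: (@le_trans _ _ (\sum_(c : ix) `|r|)).
      apply: ler_sum => c _; rewrite crd_of.
      exact: rV_entry_le.
    by rewrite sumr_const mulr_natl.
  by rewrite mulrA mulrDl mul1r lerDl.
have cf : continuous f.
  move=> r; have Fr : ProperFilter (nbhs r) by exact: nbhs_pfilter.
  apply/(@cvgrPdist_lt _ _ _ (nbhs r) Fr) => e e0; near=> s.
  apply: le_lt_trans (_ : K * `|r - s| < e).
    by apply: le_trans (f_le _); rewrite /f toxB; exact: rnorm_dist.
  rewrite mulrC -ltr_pdivlMr//; near: s.
  by apply: cvgr_dist_lt => //; rewrite divr_gt0.
pose S := [set r : 'rV[R]_(n + n) | `|r| = 1].
have cS : compact S.
  apply: bounded_closed_compact.
    by exists 1; split => // x x1 r /= ->; exact: ltW.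
  apply: (@closed_comp _ _ (fun r : 'rV[R]_(n + n) => `|r|) [set 1]).
    by move=> r _; exact: norm_continuous.
  exact: closed_eq.
have [e e0 he] : exists2 e, 0 < e & forall r, S r -> e <= f r.
  (* The sphere is empty when n = 0. *)
  have [S0|/set0P S0] := eqVneq S set0.
    by exists 1 => // r; rewrite S0.
  have [r0 /set_mem Sr0 hr0] := EVT_min_rV S0 cS (continuous_subspaceT cf).
  exists (f r0) => [|r Sr]; last by apply: hr0; exact/mem_set.
  rewrite lt_neqAle rnorm_ge0 andbT eq_sym; apply/eqP => /rnorm0_eq0 r00.
  move: Sr0; rewrite /S/=; suff -> : r0 = 0.
    by rewrite normr0 => /eqP; rewrite eq_sym oner_eq0.
  apply/matrixP => a i; rewrite (ord1 a) mxE.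
  rewrite -(splitK i); case: (fintype.split i) => k /=.
    by have := congr1 (crd (k, false)) r00; rewrite crd_of crd0.
  by have := congr1 (crd (k, true)) r00; rewrite crd_of crd0.
exists e^-1 => [|c x]; first by rewrite invr_gt0.
pose r : 'rV[R]_(n + n) := row_mx (\row_k crd (k, false) x) (\row_k crd (k, true) x).
have xE : x = tox r.
  apply: crd_inj => -[k []]; rewrite crd_of/= ?row_mxEl ?row_mxEr mxE//.
have cr : `|crd c x| <= `|r|.
  by rewrite [in leLHS]xE crd_of; exact: rV_entry_le.
apply: (le_trans cr); rewrite mulrC ler_pdivlMr//.
have [->|r0] := eqVneq `|r| 0; first by rewrite mul0r rnorm_ge0.
have r_gt0 : 0 < `|r| by rewrite lt_neqAle eq_sym r0 normr_ge0.
have /he : S (`|r|^-1 *: r).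
  by rewrite /S/= normrZ ger0_norm ?invr_ge0// mulVf.
have -> : f (`|r|^-1 *: r) = `|r|^-1 * rnorm x.
  rewrite /f; have -> : tox (`|r|^-1 *: r) = (`|r|^-1)%:C *: x.
    by rewrite xE; apply: crd_inj => c'; rewrite crdZ !crd_of mxE.
  by rewrite rnormZ gtr0_norm// invr_gt0.
by rewrite ler_pdivlMl.
Unshelve. all: by end_near. Qed.

(** Each direction uses one half of the norm equivalence. Derivatives and continuity in C^n are
    reduced to real limits in this way. *)
Lemma cvg_crdP {T : Type} (F : set_system T) (FF : Filter F) (f : T -> Cn) (l : Cn) :
  f @ F --> l <-> forall c, crd c (f x) @[x --> F] --> crd c l.
Proof.
split=> [/cvg_rnormP fl c|fl].
  have [B B0 hB] := crd_le_rnorm.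
  apply/cvgrPdist_lt => e e0; have := fl (e / B).
  rewrite divr_gt0// => /(_ isT); apply: filterS => x xe.
  by rewrite -crdB (le_lt_trans (hB _ _))// mulrC -ltr_pdivlMr.
have [A A0 hA] := rnorm_le_crd.
apply/cvg_rnormP => e e0.
pose d := e / (A * (#|{: ix}|%:R + 1)).
have K0 : 0 < (#|{: ix}|%:R + 1 : R) by rewrite ltr_wpDl.
have d0 : 0 < d by rewrite divr_gt0// mulr_gt0.
have : \forall x \near F, forall c : ix, `|crd c l - crd c (f x)| < d.
  apply: filter_forall => c.
  by move: (fl c) => /cvgrPdist_lt/(_ _ d0).
apply: filterS => x xd; apply: le_lt_trans (hA _) _.
rewrite mulrC -ltr_pdivlMr//; apply: (@le_lt_trans _ _ (\sum_(c : ix) d)).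
  by apply: ler_sum => c _; rewrite crdB ltW.
rewrite sumr_const -mulr_natl /d ltr_pdivlMr//.
rewrite mulrAC -mulrA; set u := #|_|%:R.
rewrite [ltLHS](_ : _ = e * (u / (u + 1))); last first.
  by rewrite /u; field; apply/andP; split; exact: lt0r_neq0.
by rewrite gtr_pMr// ltr_pdivrMr// mul1r ltrDl.
Qed.

End coordinates.

(** * Continuity of segments *)

Lemma continuous_to_subtype (R : realType) (X : topologicalType) (A : set R)
    (G : X -> set_type A) :
  continuous (fun x => set_val (G x)) -> continuous G.
Proof. by move=> cG; exact: (continuous_comp_initial (w := set_val) cG). Qed.

(** Turns a map known to be continuous only on a half-line into a continuous map on the line, with
    the same values wherever [g] is the identity. *)
Lemma within_retract_continuous (R : realType) (Y : topologicalType)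
    (A : set R) (g : R -> R) (v : R -> Y) :
  (forall x, A (g x)) -> continuous g -> {within A, continuous v} ->
  continuous (v \o g).
Proof.
move=> gA cg /subspace_sigL_continuousP cv x.
pose G x : set_type A := exist _ (g x) (mem_set (gA x)).
have cG : continuous G by exact: continuous_to_subtype.
exact: (@continuous_comp _ _ _ G (sigL A v) x (cG x) (cv (G x))).
Qed.

Lemma maxl_continuous (R : realType) (a : R) : continuous (Num.max a).
Proof.
by move=> x; apply: (@continuous_max _ R (fun=> a) id); [exact: cst_continuous|].
Qed.

Lemma minr_continuous (R : realType) (a : R) : continuous (fun x => Num.min x a).
Proof.
by move=> x; apply: (@continuous_min _ R id (fun=> a)); [|exact: cst_continuous].
Qed.

(** Uniform continuity in a form where [t] stays in a compact interval but [t + r] may leave it, as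
    shifted segments require. A covering argument gives one radius, halved so that centre and
    increment share it. *)
Lemma heine (R : realType) (K : numFieldType) (V : normedModType K) (f : R -> V) :
  continuous f -> forall (a b : R) (e : K), 0 < e -> exists2 d : R, 0 < d &
    forall t, a <= t <= b -> forall r, `|r| < d -> `|f (t + r) - f t| < e.
Proof.
move=> cf a b e e0.
have e20 : 0 < e / 2 by rewrite divr_gt0.
have /compact_near_coveringP/(_ R (at_right (0 : R)) (fun d x =>
    forall r, `|r| < d -> `|f (x + r) - f x| < e) _) := @segment_compact R a b.
case.
  move=> x _; move: (cf x).
  move=> /(@cvgrPdist_lt _ _ _ (nbhs x) (nbhs_filter x)) /(_ _ e20).
  move=> /nbhs_ballP[d /= d0 hd].
  exists (ball x (d / 2), [set u | u < d / 2]) => /=.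
    by split; [apply: nbhsx_ballx; lra|apply: nbhs_right_lt; lra].
  move=> [y u] /= [xy ud] r ru.
  rewrite -[X in X - _](subrK (f x)) -addrA [X in _ < X](splitr e).
  apply: le_lt_trans (ler_normD _ _) _; rewrite ltrD//.
    rewrite distrC; apply: hd; move: xy; rewrite /ball/= => xy.
    rewrite opprD addrA; apply: le_lt_trans (ler_normB _ _) _; lra.
  by apply: hd; move: xy; rewrite /ball/= => xy; lra.
move=> d /= d0 hd.
exists (d / 2) => [|t tab r rd]; first by rewrite divr_gt0.
apply: (hd (d / 2)) => //=.
- by rewrite sub0r normrN ger0_norm; lra.
- by lra.
Qed.

Section segments.
Context {R : realType} {h : {posnum R}}.
Local Notation I := (itvI h).

Lemma valI_itv (s : I) : - h%:num <= valI s <= 0.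
Proof. by case: s => x /[dup] /set_mem; rewrite /valI /= in_itv. Qed.

Fact projI_subproof (t : R) :
  Num.max (- h%:num) (Num.min t 0) \in `[- h%:num, 0]%classic.
Proof.
apply/mem_set; rewrite /= in_itv/= le_max lexx/= ge_max oppr_le0 ge0 ge_min.
by rewrite lexx orbT.
Qed.

(** The retraction of the line onto I; composing with it extends a function on I constantly on both
    sides. *)
Definition projI (t : R) : I :=
  exist (fun x => x \in `[- h%:num, 0]%classic) _ (projI_subproof t).

Lemma valI_projI t : valI (projI t) = Num.max (- h%:num) (Num.min t 0).
Proof. by []. Qed.

Lemma valI_projI_in t : - h%:num <= t <= 0 -> valI (projI t) = t.
Proof. by move=> /andP[ht t0]; rewrite valI_projI min_l// max_r. Qed.

Lemma projIK (s : I) : projI (valI s) = s.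
Proof. by apply: val_inj; rewrite [LHS]valI_projI_in// valI_itv. Qed.

Lemma projI_continuous : continuous projI.
Proof.
apply: continuous_to_subtype.
have -> : (fun x => set_val (projI x)) =
  Num.max (- h%:num) \o (fun x => Num.min x 0) by [].
move=> t; have := (@continuous_comp R R R (fun x => Num.min x 0) (Num.max (- h%:num)) t
  (@minr_continuous _ 0 t) (@maxl_continuous _ _ _)).
exact.
Qed.

Lemma valI_continuous : continuous (@valI R h).
Proof. exact: initial_continuous. Qed.

End segments.

Section continuous_segments.
Context {R : realType} {n : nat} {N : cnorm R n} {h : {posnum R}}.
Local Notation I := (itvI h).
Local Notation Cn := (Cn N).
Local Notation C_cn := (contI h Cn).
Implicit Types (u v : R -> Cn).

Lemma seg_continuous v t : continuous v -> continuous (seg v t : I -> Cn).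
Proof.
move=> cv s; have ct : {for s, continuous (fun s : I => t + valI s)}.
  exact: (cvgD (cvg_cst _ (FF := nbhs_filter s)) (@valI_continuous _ _ s)).
exact: (@continuous_comp I R Cn _ v s ct (cv _)).
Qed.

Lemma csegE v t (s : I) : continuous v -> cseg v t s = v (t + valI s).
Proof.
move=> cv; rewrite /cseg /insubd insubT; last by move=> ?.
by apply/cts_predP; exact: seg_continuous.
Qed.

Lemma eq_cseg u v t : (forall s : I, u (t + valI s) = v (t + valI s)) ->
  cseg u t = cseg v t :> C_cn.
Proof. by move=> uv; congr insubd; apply/funext. Qed.

Lemma contI_eq (f g : C_cn) : (forall s, f s = g s) -> f = g.
Proof. by move=> fg; apply: val_inj; apply/funext. Qed.

Lemma contIB (f g : C_cn) s : (f - g) s = f s - g s.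
Proof. by []. Qed.

Lemma contID (f g : C_cn) s : (f + g) s = f s + g s.
Proof. by []. Qed.

Lemma contIZ (a : R[i]) (f : C_cn) s : (a *: f) s = a *: f s.
Proof. by []. Qed.

Lemma rnorm_contI_le (f : C_cn) M : 0 <= M ->
  (forall s, rnorm (f s) <= M) -> rnorm f <= M.
Proof. exact: contI_norm_le. Qed.

Lemma csegB u v t : continuous u -> continuous v ->
  cseg (fun t => u t - v t) t = cseg u t - cseg v t :> C_cn.
Proof.
move=> cu cv; apply: contI_eq => s; rewrite contIB !csegE//.
by move=> x; apply: cvgB; [exact: cu|exact: cv].
Qed.

Lemma csegD u v t : continuous u -> continuous v ->
  cseg (fun t => u t + v t) t = cseg u t + cseg v t :> C_cn.
Proof.
move=> cu cv; apply: contI_eq => s; rewrite contID !csegE//.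
by move=> x; apply: cvgD; [exact: cu|exact: cv].
Qed.

Lemma csegZ (a : R[i]) u t : continuous u ->
  cseg (fun t => a *: u t) t = a *: cseg u t :> C_cn.
Proof.
move=> cu; apply: contI_eq => s; rewrite contIZ !csegE//.
by move=> x; apply: cvgZl_tmp; exact: cu.
Qed.

(** Uniform continuity of [v] near [[t - h, t]] bounds all values of the difference of two segments
    at once. *)
Lemma cseg_continuous v : continuous v ->
  continuous (fun t => cseg v t : C_cn).
Proof.
move=> cv t; apply/(cvg_rnormP (nbhs_filter t)) => e e0.
have e20 : 0 < (e / 2)%:C by rewrite ltcR divr_gt0.
have [d d0 hd] := heine cv (t - h%:num) t e20.
exists d => //= t' tt'; apply: (@le_lt_trans _ _ (e / 2)); last by lra.
apply: rnorm_contI_le => [|s]; first by lra.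
rewrite contIB !csegE// -lecR -rnormE distrC ltW//.
have -> : t' + valI s = t + valI s + (t' - t) by ring.
apply: hd; last by rewrite distrC.
by have := valI_itv s; lra.
Qed.

End continuous_segments.

Section Delta_bound.
Context {R : realType} {n : nat} {N : cnorm R n} {h : {posnum R}}.
Local Notation Cn := (Cn N).
Local Notation C_cn := (contI h Cn).

Lemma contI_projI_continuous (psi : C_cn) : continuous (psi \o projI).
Proof.
move=> t; apply: continuous_comp; first exact: projI_continuous.
by have /cts_predP := contI_cts psi; apply.
Qed.

Lemma Delta_bounded (L : Lc C_cn Cn) : Delta_cond L ->
  exists2 D : R, 0 < D & exists2 C : R, 0 < C &
    forall (psi : C_cn) M, 0 <= M ->
      (forall s, valI s <= - D -> rnorm (psi s) <= M) -> rnorm (L psi) <= C * M.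
Proof.
move=> [D /andP[D0 Dh] LD]; exists D => //.
have [C C0 hC] := Lc_bounded L; exists C => // psi M M0 psiM.
pose f (s : itvI h) := (psi \o projI) (Num.min (valI s) (- D)).
have cf : continuous f.
  have cm : continuous (fun s : itvI h => Num.min (valI s) (- D)).
    move=> s; exact: (@continuous_comp _ _ _ (@valI R h)
      (fun x => Num.min x (- D)) s (@valI_continuous _ _ s)
      (@minr_continuous _ _ _)).
  move=> s; exact: (@continuous_comp _ _ _ _ (psi \o projI) s (cm s)
    (@contI_projI_continuous psi _)).
pose psi' : C_cn := ContI (introT (cts_predP f) cf).
have -> : L psi = L psi'.
  apply/eqP; rewrite -subr_eq0 -linearB; apply/eqP/LD => s sD.
  by rewrite contIB /psi' /= /f /= min_l// projIK subrr.
apply: le_trans (hC _) _; rewrite ler_pM2l//.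
apply: rnorm_contI_le => // s; apply: psiM.
rewrite valI_projI_in; first by rewrite ge_min lexx orbT.
by have := valI_itv s; rewrite le_min ge_min; lra.
Qed.

End Delta_bound.

(** * Primitives and the weighted contraction *)

Section primitive.
Context {R : realType}.
Local Notation mu := (@lebesgue_measure R).
Implicit Types F : R -> R.

Lemma continuous_integrable_itv F a b : continuous F ->
  mu.-integrable `[a, b] (EFin \o F).
Proof.
move=> cF; apply: continuous_compact_integrable; first exact: segment_compact.
exact: continuous_subspaceT.
Qed.

(* The base point -1 makes [prim F] differentiable from both sides at 0. *)
Definition prim F (t : R) : R :=
  Rintegral mu `[-1, t] F - Rintegral mu `[-1, 0] F.

Lemma prim_is_derive F (t : R) : continuous F -> -1 < t ->
  is_derive t 1 (prim F) (F t).
Proof.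
move=> cF t1.
have [dF F'] := continuous_FTC1_closed (ltr_pwDr (@ltr01 R) (lexx t))
  (continuous_integrable_itv _ _ cF) t1 (cF t).
pose P x := Rintegral mu `[-1, x] F.
have dP : is_derive t 1 P (F t) by split; [exact: dF|rewrite -derive1E].
have -> : prim F = P - cst (P 0) by [].
by rewrite -[F t]subr0; apply: is_deriveB.
Qed.

Lemma prim_continuous F (t : R) : continuous F -> -1 < t ->
  {for t, continuous (prim F)}.
Proof.
move=> cF t1; apply: differentiable_continuous; apply/derivable1_diffP.
by have [] := prim_is_derive cF t1.
Qed.

Lemma prim0 F : prim F 0 = 0.
Proof. by rewrite /prim subrr. Qed.

Lemma primE F (t : R) : continuous F -> 0 <= t ->
  prim F t = Rintegral mu `]0, t[ F.
Proof.
move=> cF t0; rewrite /prim Rintegral_itvB//.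
- rewrite -Rintegral_itv_bndo_bndc//.
  apply: (@integrableS _ _ _ mu `[0, t]%classic `]0, t[%classic) => //.
    by apply: subset_itv; rewrite bnd_simp.
  exact: continuous_integrable_itv.
- exact: continuous_integrable_itv.
- by rewrite bnd_simp; lra.
Qed.

Lemma is_derive_cvgP (g : R -> R) (t l : R) :
  is_derive t 1 g l <-> r^-1 * (g (t + r) - g t) @[r --> 0^'] --> l.
Proof.
have gE : (fun r : R => r^-1 * (g (t + r) - g t)) =
    (fun r : R => r^-1 *: ((g \o shift t) (r *: 1) - g t)).
  by apply/funext => r /=; rewrite /GRing.scale/= mulr1 [r + t]addrC.
rewrite gE; split=> [[dg <-]|dg]; first exact: dg.
split; first by apply/cvg_ex; exists l.
exact: cvg_lim dg.
Qed.

(* Comparison of the derivative of [f] with that of [A / g * expR (g * s)]. *)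
Lemma expR_mean_value (f df : R -> R) (A g t : R) : 0 <= A -> 0 < g -> 0 <= t ->
  continuous f -> (forall s : R, 0 < s -> s <= t -> is_derive s 1 f (df s)) ->
  f 0 = 0 -> (forall s : R, 0 < s -> s <= t -> `|df s| <= A * expR (g * s)) ->
  `|f t| <= A / g * expR (g * t).
Proof.
move=> A0 g0; rewrite le_eqVlt => /predU1P[<- _ _ -> _|t0 cf f' f0 hf].
  by rewrite normr0 mulr_ge0 ?expR_ge0// divr_ge0// ltW.
pose E s := A / g * expR (g * s).
have E' (s : R) : is_derive s 1 E (A * expR (g * s)).
  have -> : A * expR (g * s) = A / g *: (expR (g * s) *: (g *: (1 : R))).
    rewrite /GRing.scale/= mulr1; field; exact: lt0r_neq0.
  apply: is_deriveZ; apply: (@is_derive1_comp _ expR (fun s => g *: s)).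
have cE : continuous E.
  move=> s; apply: differentiable_continuous; apply/derivable1_diffP.
  by have [] := E' s.
have E0 : 0 <= E 0 by rewrite mulr_ge0 ?expR_ge0// divr_ge0// ltW.
(* [E + f] and [E - f] have nonnegative derivatives on []0, t[] and a nonnegative value at 0, hence
   are nonnegative at [t]. *)
rewrite -/(E t) ler_norml; apply/andP; split.
- have [s| |c /[!in_itv]/= /andP[c0 ct]] := @MVT _ (E + f)
    (fun s => A * expR (g * s) + df s) 0 t t0.
    rewrite in_itv/= => /andP[s0 st]; apply: is_deriveD; exact: f' (ltW st).
  by apply: continuous_subspaceT => s; apply: cvgD; [exact: cE|exact: cf].
  rewrite -[(E + f) t]/(E t + f t) -[(E + f) 0]/(E 0 + f 0) f0 => Et.
  suff : 0 <= (A * expR (g * c) + df c) * (t - 0) by rewrite -Et; lra.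
  have := hf c c0 (ltW ct); rewrite ler_norml => /andP[dl _].
  by rewrite subr0 mulr_ge0 ?(ltW t0)//; lra.
- have [s| |c /[!in_itv]/= /andP[c0 ct]] := @MVT _ (E - f)
    (fun s => A * expR (g * s) - df s) 0 t t0.
    rewrite in_itv/= => /andP[s0 st]; apply: is_deriveB; exact: f' (ltW st).
  by apply: continuous_subspaceT => s; apply: cvgB; [exact: cE|exact: cf].
  rewrite -[(E - f) t]/(E t - f t) -[(E - f) 0]/(E 0 - f 0) f0 => Et.
  suff : 0 <= (A * expR (g * c) - df c) * (t - 0) by rewrite -Et; lra.
  have := hf c c0 (ltW ct); rewrite ler_norml => /andP[_ dl].
  by rewrite subr0 mulr_ge0 ?(ltW t0)//; lra.
Qed.

End primitive.

Section derivative.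
Context {R : realType} {n : nat} {N : cnorm R n}.
Local Notation Cn := (Cn N).
Implicit Types (f g : R -> Cn) (l : Cn).

Lemma has_deriv_crdP f (t : R) l : has_deriv f t l <-> forall c,
  r^-1 * (crd c (f (t + r)) - crd c (f t))
    @[r --> within [set r | 0 <= t + r] 0^'] --> crd c l.
Proof.
have E c : (fun r => crd c ((r^-1)%:C *: (f (t + r) - f t))) =
    (fun r => r^-1 * (crd c (f (t + r)) - crd c (f t))).
  by apply/funext => r; rewrite crdZ crdB.
split=> [/cvg_crdP fl c|fl]; first by rewrite -E.
by apply/cvg_crdP => c; rewrite E.
Qed.

Lemma has_deriv_is_derive f (t : R) l : 0 < t -> has_deriv f t l ->
  forall c, is_derive t 1 (crd c \o f) (crd c l).
Proof.
move=> t0 /has_deriv_crdP fl c; apply/is_derive_cvgP.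
apply: cvg_trans (fl c); apply: cvg_fmap2 => A; rewrite /within/= => HA.
have : \forall r \near (0 : R)^', 0 <= t + r.
  apply: cvg_within; near=> r.
  suff : `|r| < t by rewrite ltr_norml; lra.
  by near: r; apply: (@nbhs0_lt R R).
by move: HA; apply: filterS2 => r H /H.
Unshelve. all: by end_near. Qed.

(** At [t = 0] this yields the one-sided derivative: [f] is controlled only on the half-line, but
    agrees there with a map [g] differentiable from both sides. *)
Lemma is_derive_has_deriv f g (t : R) l : 0 <= t ->
  (forall s, 0 <= s -> f s = g s) ->
  (forall c, is_derive t 1 (crd c \o g) (crd c l)) -> has_deriv f t l.
Proof.
move=> t0 fg gl; apply/has_deriv_crdP => c.
have /is_derive_cvgP/(cvg_within_filter [set r | 0 <= t + r]) := gl c.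
apply: cvg_trans; apply: fmap_within_eq.
by move=> r /set_mem /= r0; rewrite !fg.
Qed.

Lemma eq_has_deriv f g (t : R) l : 0 <= t ->
  (forall s, 0 <= s -> f s = g s) -> has_deriv f t l -> has_deriv g t l.
Proof.
move=> t0 fg; apply: cvg_trans; apply: fmap_within_eq.
by move=> r /set_mem /= r0; rewrite !fg.
Qed.

Lemma has_derivD f g (t : R) l m : has_deriv f t l -> has_deriv g t m ->
  has_deriv (fun t => f t + g t) t (l + m).
Proof.
move=> fl gm; rewrite /has_deriv.
under eq_fun do rewrite opprD addrACA scalerDr.
exact: cvgD.
Qed.

Lemma has_derivZ (a : R[i]) f (t : R) l : has_deriv f t l ->
  has_deriv (fun t => a *: f t) t (a *: l).
Proof.
move=> fl; rewrite /has_deriv.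
under eq_fun do rewrite -scalerBr scalerA mulrC -scalerA.
exact: cvgZl_tmp.
Qed.

Lemma has_derivB f g (t : R) l m : has_deriv f t l -> has_deriv g t m ->
  has_deriv (fun t => f t - g t) t (l - m).
Proof.
move=> fl gm; rewrite -[- m]scaleN1r.
have -> : (fun t => f t - g t) = (fun t => f t + (-1) *: g t).
  by apply/funext => s; rewrite scaleN1r.
exact: has_derivD fl (has_derivZ gm).
Qed.

End derivative.

Section contraction.
Context {R : realType} {n : nat} {N : cnorm R n} {h : {posnum R}}.
Local Notation Cn := (Cn N).
Local Notation C_cn := (contI h Cn).
Context (L Rop : Lc C_cn Cn) (HL : Delta_cond L).

Lemma Lc_cseg_continuous (M : Lc C_cn Cn) (v : R -> Cn) : continuous v ->
  continuous (fun t => M (cseg v t)).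
Proof.
move=> cv t; exact: (@continuous_comp R C_cn Cn (cseg v) M t
  (@cseg_continuous _ _ _ _ v cv t) (@Lc_cts _ _ _ M _)).
Qed.

(* The delay makes the neutral term small, and the integration makes the
   retarded term small, in the norm weighted by [expR (- g * t)]. *)
Lemma weighted_contraction : exists2 g : R, 0 < g &
  forall d D : R -> Cn, continuous d -> continuous D ->
  (forall t, t <= 0 -> d t = 0) -> D 0 = 0 ->
  (forall t, 0 < t ->
    has_deriv (fun t => D t - L (cseg d t)) t (Rop (cseg d t))) ->
  forall T K, 0 <= K ->
  (forall t, 0 <= t <= T -> rnorm (d t) <= K * expR (g * t)) ->
  forall t, 0 <= t <= T -> rnorm (D t) <= K / 2 * expR (g * t).
Proof.
have [De De0 [CL CL0 hL]] := Delta_bounded HL.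
have [CR CR0 hR] := Lc_bounded Rop.
have [A A0 hA] := @rnorm_le_crd R n N.
have [B B0 hB] := @crd_le_rnorm R n N.
pose k : R := #|{: 'I_n * bool}|%:R.
have k0 : 0 <= k by [].
(* [u] makes the delay factor [CL * expR (- g * De)] at most 1/4, and [w] makes the integration
   factor [A * k * (B * CR) / g] at most 1/4; the two quarters add up to the final 1/2. *)
pose u := 4 * CL / De; pose w := 4 * (A * k * (B * CR)).
have u0 : 0 < u by rewrite divr_gt0// mulr_gt0.
have w0 : 0 <= w by rewrite mulr_ge0// !mulr_ge0// ?mulr_ge0// ltW.
pose g := u + w + 1; have g0 : 0 < g by rewrite /g; lra.
(* [d] stands for a difference of inputs of the fixed-point map and [D] for the difference of the
   outputs; for two solutions the two coincide. *)
exists g => // d D cd cD d0 D0 D' T K K0 dK t /andP[t0 tT].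
have E0 s : 0 < expR (g * s) by exact: expR_gt0.
have dle s : s <= t -> forall b, s <= b -> rnorm (d s) <= K * expR (g * b).
  move=> st b sb; have [s0|s0] := leP s 0.
    by rewrite d0// rnorm0 mulr_ge0// ltW.
  apply: le_trans (dK s _) _; first by lra.
  by rewrite ler_wpM2l// ler_expR ler_pM2l.
have segle s : s <= t -> rnorm (cseg d s : C_cn) <= K * expR (g * s).
  move=> st; apply: rnorm_contI_le => [|r]; first by rewrite mulr_ge0// ltW.
  by have := valI_itv r; rewrite csegE// => rI; apply: dle; lra.
have Lle : rnorm (L (cseg d t)) <= K / 4 * expR (g * t).
  apply: (@le_trans _ _ (CL * (K * expR (g * (t - De))))).
    apply: hL => [|s sD]; first by rewrite mulr_ge0// ltW.
    by have := valI_itv s; rewrite csegE// => sI; apply: dle; lra.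
  rewrite mulrBr expRB; set e := expR (g * t); set x := expR (g * De).
  have x0 : 0 < x by exact: expR_gt0.
  have ux : 4 * CL <= x.
    apply: (@le_trans _ _ (1 + g * De)); last exact: expR_ge1Dx.
    have : u * De <= g * De by rewrite ler_pM2r// /g; lra.
    by rewrite {1}/u divfK ?lt0r_neq0//; lra.
  have -> : CL * (K * (e / x)) = (K * e) * (CL / x) by ring.
  have -> : K / 4 * e = (K * e) * 4^-1 by ring.
  rewrite ler_wpM2l ?mulr_ge0 ?expR_ge0// ler_pdivrMr//; lra.
pose f s := D s - L (cseg d s).
have cf : continuous f.
  move=> s; apply: (cvgB (cD s)).
  exact: Lc_cseg_continuous.
have f00 : f 0 = 0.
  rewrite /f D0 (_ : cseg d 0 = 0 :> C_cn) ?[L 0]linear0 ?subr0//.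
  apply: contI_eq => s; rewrite csegE// d0//.
  by have := valI_itv s; lra.
have fle c : `|crd c (f t)| <= B * CR * K / g * expR (g * t).
  apply: (@expR_mean_value _ (crd c \o f) (fun s => crd c (Rop (cseg d s)))) => //.
  - by rewrite !mulr_ge0// ltW.
  - by move=> s; have /cvg_crdP := cf s; apply.
  - by move=> s s0 st; apply: has_deriv_is_derive => //; exact: D'.
  - by rewrite /= f00 crd0.
  - move=> s s0 st; apply: le_trans (hB _ _) _; rewrite -!mulrA ler_pM2l//.
    by apply: le_trans (hR _) _; rewrite ler_pM2l// segle.
have fN : rnorm (f t) <= K / 4 * expR (g * t).
  apply: le_trans (hA _) _.
  apply: (@le_trans _ _ (A * (k * (B * CR * K / g * expR (g * t))))).
    rewrite ler_pM2l// (le_trans (ler_sum _ (fun c _ => fle c)))//.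
    by rewrite sumr_const mulr_natl.
  set e := expR (g * t).
  have -> : A * (k * (B * CR * K / g * e)) = (K * e) * (w / 4 / g).
    by rewrite /w; field; exact: lt0r_neq0.
  have -> : K / 4 * e = (K * e) * 4^-1 by ring.
  rewrite ler_wpM2l ?mulr_ge0 ?expR_ge0// ler_pdivrMr// /g; lra.
have -> : D t = f t + L (cseg d t) by rewrite subrK.
apply: le_trans (rnormD _ _) _; apply: le_trans (lerD fN Lle) _; lra.
Qed.

End contraction.

(** * Uniqueness and existence of solutions *)

Lemma le_geometric_eq0 (R : realType) (x C : R) : 0 <= x ->
  (forall m : nat, x <= C / 2 ^+ m) -> x = 0.
Proof.
move=> x0 xC; apply/eqP; rewrite eq_le x0 andbT.
have c0 : C * 2^-1 ^+ m @[m --> \oo] --> (0 : R).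
  by apply: cvg_geometric; rewrite ger0_norm ?invr_ge0// invf_lt1//; lra.
apply: (@cvgr_to_ge _ _ _ _ _ _ x c0); apply: nearW => m.
by rewrite exprVn.
Qed.

Lemma subrACA (V : zmodType) (a b c e : V) :
  (a - b) - (c - e) = (a - c) - (b - e).
Proof. by rewrite !opprD addrACA. Qed.

Section uniqueness.
Context {R : realType} {n : nat} {N : cnorm R n} {h : {posnum R}}.
Local Notation Cn := (Cn N).
Local Notation C_cn := (contI h Cn).
Context (L Rop : Lc C_cn Cn).

Lemma continuous_bounded_itv (d : R -> Cn) T : 0 <= T -> continuous d ->
  exists2 K, 0 <= K & forall t, 0 <= t <= T -> rnorm (d t) <= K.
Proof.
move=> T0 cd.
have cr : continuous (fun t => rnorm (d t)).
  move=> t; apply/(@cvgrPdist_lt _ _ _ (nbhs t) (nbhs_filter t)) => e e0.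
  have /(cvg_rnormP (nbhs_filter t))/(_ e e0) := cd t.
  by apply: filterS => s; apply: le_lt_trans; exact: rnorm_dist.
have [c _ hc] := EVT_max T0 (continuous_subspaceT cr).
by exists (rnorm (d c)) => [|t t0T]; [exact: rnorm_ge0|apply: hc; rewrite in_itv].
Qed.

(** Extends [v] constantly to the left of [-h]: a solution becomes continuous on the whole line,
    where [csegE] applies, and no segment at a time [t >= 0] changes. *)
Definition clamp (v : R -> Cn) : R -> Cn := v \o Num.max (- h%:num).

Lemma clampE v t : - h%:num <= t -> clamp v t = v t.
Proof. by move=> ht; rewrite /clamp /= max_r. Qed.

Lemma cseg_clamp v t : 0 <= t -> cseg (clamp v) t = cseg v t :> C_cn.
Proof.
move=> t0; apply: eq_cseg => s; rewrite clampE//.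
by have := valI_itv s; lra.
Qed.

Lemma clamp_continuous v : {within `[- h%:num, +oo[, continuous v} ->
  continuous (clamp v).
Proof.
apply: within_retract_continuous; last exact: maxl_continuous.
by move=> x; rewrite /= in_itv/= le_max lexx.
Qed.

Lemma solution_clamp q v : solution L Rop q v ->
  continuous (clamp v) /\ forall t, 0 <= t ->
    has_deriv (fun t => clamp v t - L (cseg (clamp v) t)) t
      (Rop (cseg (clamp v) t) + q t).
Proof.
move=> [cv v']; split; first exact: clamp_continuous.
move=> t t0; rewrite cseg_clamp//; apply: eq_has_deriv (v' t t0) => // s s0.
rewrite cseg_clamp// clampE//.
by have : 0 < h%:num by []; lra.
Qed.

Lemma continuous_solution q v : continuous v -> (forall t, 0 <= t ->
    has_deriv (fun t => v t - L (cseg v t)) t (Rop (cseg v t) + q t)) ->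
  solution L Rop q v.
Proof. by move=> cv v'; split => //; exact: continuous_subspaceT. Qed.

Lemma solutionD q1 q2 u v : continuous u -> continuous v ->
  solution L Rop q1 u -> solution L Rop q2 v ->
  solution L Rop (fun t => q1 t + q2 t) (fun t => u t + v t).
Proof.
move=> cu cv [_ u'] [_ v']; apply: continuous_solution => [t|t t0].
  by apply: cvgD; [exact: cu|exact: cv].
rewrite csegD// linearD addrACA.
apply: eq_has_deriv (has_derivD (u' t t0) (v' t t0)) => // s s0.
by rewrite csegD// linearD opprD addrACA.
Qed.

Lemma solutionZ (a : R[i]) q u : continuous u -> solution L Rop q u ->
  solution L Rop (fun t => a *: q t) (fun t => a *: u t).
Proof.
move=> cu [_ u']; apply: continuous_solution => [t|t t0].
  by apply: cvgZl_tmp; exact: cu.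
rewrite csegZ// linearZ -scalerDr.
apply: eq_has_deriv (has_derivZ (a := a) (u' t t0)) => // s s0.
by rewrite csegZ// linearZ -scalerBr.
Qed.

(** The difference [d] of two solutions is both input and output of the contraction, so its weighted
    bound on [[0, t]] can be halved indefinitely. *)
Lemma solution_unique q v w : Delta_cond L ->
  solution L Rop q v -> solution L Rop q w ->
  (forall s : itvI h, v (valI s) = w (valI s)) ->
  forall t, - h%:num <= t -> v t = w t.
Proof.
move=> HL /solution_clamp[cv v'] /solution_clamp[cw w'] vw t ht.
have [g g0 hg] := weighted_contraction Rop HL.
pose d s := clamp v s - clamp w s.
have cd : continuous d by move=> s; apply: cvgB; [exact: cv|exact: cw].
have d0 s : s <= 0 -> d s = 0.
  move=> s0; rewrite /d /clamp /=; set r := Num.max _ _.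
  have rI : - h%:num <= r <= 0.
    by rewrite /r le_max lexx ge_max s0 andbT/= oppr_le0.
  by rewrite -(valI_projI_in rI) vw subrr.
have d' s : 0 < s -> has_deriv (fun t => d t - L (cseg d t)) s (Rop (cseg d s)).
  move=> s0; have s0' := ltW s0.
  have -> : Rop (cseg d s) = (Rop (cseg (clamp v) s) + q s) -
     (Rop (cseg (clamp w) s) + q s).
    by rewrite csegB// linearB opprD addrACA subrr addr0.
  apply: eq_has_deriv (has_derivB (v' s s0') (w' s s0')) => // r r0.
  by rewrite csegB// [L (_ - _)]linearB subrACA.
have [t0|t0] := leP t 0.
  by have /eqP := d0 t t0; rewrite /d !clampE// subr_eq0 => /eqP.
have [K K0 hK] := continuous_bounded_itv (ltW t0) cd.
have dm m s : 0 <= s <= t -> rnorm (d s) <= K / 2 ^+ m * expR (g * s).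
  elim: m s => [|m IH] s st.
    rewrite expr0 divr1; apply: le_trans (hK _ st) _.
    rewrite ler_peMr// -expR0 ler_expR mulr_ge0//; first exact: ltW.
    by move/andP: st => [].
  rewrite exprSr invfM mulrA; apply: (hg d d _ _ _ _ _ t) => //.
  - exact: d0.
  - by rewrite divr_ge0// exprn_ge0.
suff : d t = 0 by move=> /eqP; rewrite /d !clampE// subr_eq0 => /eqP.
apply: rnorm0_eq0; apply: (@le_geometric_eq0 _ _ (K * expR (g * t))) => [|m].
  exact: rnorm_ge0.
by rewrite mulrAC dm// lexx ltW.
Qed.

End uniqueness.

(** * Existence by Picard iteration *)

Section existence.
Context {R : realType} {n : nat} {N : cnorm R n} {h : {posnum R}}.
Local Notation Cn := (Cn N).
Local Notation C_cn := (contI h Cn).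

Definition cprim (F : R -> Cn) (t : R) : Cn :=
  of_crd (fun c => prim (crd c \o F) t).

Lemma crd_continuous (F : R -> Cn) c : continuous F -> continuous (crd c \o F).
Proof. by move=> cF t; have /cvg_crdP := cF t; apply. Qed.

Lemma cprim_is_derive (F : R -> Cn) (t : R) c : continuous F -> -1 < t ->
  is_derive t 1 (crd c \o cprim F) (crd c (F t)).
Proof.
move=> cF t1; have -> : crd c \o cprim F = prim (crd c \o F).
  by apply/funext => s; rewrite /= /cprim crd_of.
by apply: prim_is_derive => //; exact: crd_continuous.
Qed.

(** The primitive is controlled only to the right of its base point -1, so its argument is clamped
    at 0 to obtain a continuous map on the line. *)
Lemma cprim_continuous (F : R -> Cn) : continuous F ->
  continuous (fun t : R => cprim F (Num.max 0 t)).
Proof.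
move=> cF t; apply/cvg_crdP => c; rewrite /cprim crd_of.
have -> : (fun s => crd c (cprim F (Num.max 0 s))) =
    prim (crd c \o F) \o Num.max 0.
  by apply/funext => s; rewrite /= /cprim crd_of.
apply: (@continuous_comp R R R _ _ t (@maxl_continuous R 0 t)).
apply: prim_continuous; first exact: crd_continuous.
by rewrite lt_max; apply/orP; left; lra.
Qed.

Lemma cprim0 (F : R -> Cn) : cprim F 0 = 0.
Proof. by apply: crd_inj => c; rewrite /cprim crd_of prim0 crd0. Qed.

Context (L Rop : Lc C_cn Cn).

(** Passage from the integral equation to the differential one, for the Picard limit as well as for
    the convolution with a column. The primitive is differentiable from both sides at 0, which
    settles the right derivative there. *)
Lemma integral_solution (v q : R -> Cn) (a : Cn) :
  continuous v -> continuous q ->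
  (forall t, 0 <= t ->
     v t - L (cseg v t) = a + cprim (fun s => Rop (cseg v s) + q s) t) ->
  forall t, 0 <= t ->
    has_deriv (fun t => v t - L (cseg v t)) t (Rop (cseg v t) + q t).
Proof.
move=> cv cq vE t t0.
set F := fun s => Rop (cseg v s) + q s.
have cF : continuous F.
  by move=> s; apply: cvgD (cq s); exact: Lc_cseg_continuous.
apply: (is_derive_has_deriv (g := fun t => a + cprim F t) t0 vE) => c.
rewrite -[crd c _]add0r.
have -> : crd c \o (fun t => a + cprim F t) = cst (crd c a) + (crd c \o cprim F).
  by apply/funext => s; rewrite !fctE /= crdD.
apply: is_deriveD; apply: (@cprim_is_derive F t c cF); lra.
Qed.

Section picard.
Context (phi : C_cn) (q : R -> Cn) (cq : continuous q) (HL : Delta_cond L).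

(** Fixed points that start in [phi] solve the integral equation. Since [projI t] is the point 0 for
    [t >= 0], the first term is [phi] at 0 there; for [t <= 0] the maximum switches the other terms
    off whenever [v] starts in [phi]. *)
Definition picard (v : R -> Cn) (t : R) : Cn :=
  phi (projI t) + (L (cseg v (Num.max 0 t)) - L phi)
  + cprim (fun s => Rop (cseg v s) + q s) (Num.max 0 t).

Let good (v : R -> Cn) := continuous v /\ forall t : R, t <= 0 -> v t = phi (projI t).

Let cseg0 v : good v -> cseg v 0 = phi.
Proof.
move=> [cv v0]; apply: contI_eq => s.
have := valI_itv s => /andP[_ s0].
by rewrite csegE// add0r v0// projIK.
Qed.

Let picard_good v : good v -> good (picard v).
Proof.
move=> gv; have [cv v0] := gv; split=> [t|t t0]; last first.
  by rewrite /picard max_l// cseg0// subrr cprim0 !addr0.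
apply: cvgD; last first.
  apply: cprim_continuous => s.
  by apply: cvgD (cq (x := s)); exact: Lc_cseg_continuous.
apply: cvgD; first exact: (@contI_projI_continuous _ _ _ _ phi t).
apply: cvgB; last exact: cvg_cst.
exact: (@continuous_comp _ _ _ (Num.max (0 : R)) (fun t => L (cseg v t)) t
  (@maxl_continuous _ _ _) (@Lc_cseg_continuous _ _ _ _ _ _ cv _)).
Qed.

Let picardE v t : good v -> 0 <= t ->
  picard v t - L (cseg v t) = (phi (I0 h) - L phi)
    + cprim (fun s => Rop (cseg v s) + q s) t.
Proof.
move=> gv t0; rewrite /picard max_r//.
have -> : projI t = I0 h.
  by apply: val_inj; rewrite [LHS]valI_projI min_r//= max_r// oppr_le0.
rewrite addrAC; congr (_ + _); rewrite -addrA; congr (_ + _).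
by rewrite addrAC subrr add0r.
Qed.

(** The initial terms and [q] cancel in the difference, leaving the homogeneous relation between
    input and output that the contraction asks for. *)
Let picard_deriv u v : good u -> good v -> forall t, 0 < t ->
  has_deriv (fun t => (picard u t - picard v t) - L (cseg (fun t => u t - v t) t))
    t (Rop (cseg (fun t => u t - v t) t)).
Proof.
move=> gu gv t t0; have [cu _] := gu; have [cv _] := gv.
pose F w s := Rop (cseg w s) + q s.
have cF w : continuous w -> continuous (F w).
  by move=> cw s; apply: cvgD (cq (x := s)); exact: Lc_cseg_continuous.
apply: (is_derive_has_deriv (g := fun t => cprim (F u) t - cprim (F v) t)).
- exact: ltW.
- move=> s s0; rewrite (csegB _ cu cv) [L (_ - _)]linearB subrACA.
  apply: etrans (congr2 (fun a b : Cn => a - b) (picardE gu s0) (picardE gv s0)) _.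
  by rewrite opprD addrACA subrr add0r.
move=> c; have -> : crd c (Rop (cseg (fun t => u t - v t) t)) =
    crd c (F u t) - crd c (F v t).
  by rewrite -crdB csegB// linearB /F opprD addrACA subrr addr0.
have -> : crd c \o (fun t => cprim (F u) t - cprim (F v) t) =
    (crd c \o cprim (F u)) - (crd c \o cprim (F v)).
  by apply/funext => s; exact: crdB.
have t1 : -1 < t by lra.
apply: is_deriveB.
  exact: cprim_is_derive (cF _ cu) t1.
exact: cprim_is_derive (cF _ cv) t1.
Qed.

Let picard_contraction : exists2 g : R, 0 < g & forall u v, good u -> good v ->
  forall T K, 0 <= K ->
  (forall t, 0 <= t <= T -> rnorm (u t - v t) <= K * expR (g * t)) ->
  forall t, 0 <= t <= T -> rnorm (picard u t - picard v t) <= K / 2 * expR (g * t).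
Proof.
have [g g0 hg] := weighted_contraction Rop HL.
exists g => // u v gu gv.
apply: (hg (fun t => u t - v t) (fun t => picard u t - picard v t)).
- by move=> t; apply: cvgB; [exact: gu.1|exact: gv.1].
- by move=> t; apply: cvgB; [exact: (picard_good gu).1|exact: (picard_good gv).1].
- by move=> t t0; rewrite gu.2// gv.2// subrr.
- by rewrite (picard_good gu).2// (picard_good gv).2// subrr.
- exact: picard_deriv.
Qed.

Let it m := iter m picard (phi \o projI).

Let it_good m : good (it m).
Proof.
elim: m => [|m IH]; last exact: picard_good.
by split=> //; exact: contI_projI_continuous.
Qed.

(** The weight is estimated by [expR (g * T)], which makes the bounds uniform on [[0, T]]; to the
    left of 0 all iterates coincide. *)
Let it_close T : 0 <= T -> exists2 K, 0 <= K & forall m k t, t <= T ->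
  rnorm (it (m + k) t - it m t) <= K / 2 ^+ m.
Proof.
move=> T0; have [g g0 hg] := picard_contraction.
have [|K K0 hK] := @continuous_bounded_itv _ _ _ (fun t => it 1 t - it 0 t) T T0.
  by move=> t; apply: cvgB; [exact: (it_good 1).1|exact: (it_good 0).1].
have step m t : 0 <= t <= T ->
    rnorm (it m.+1 t - it m t) <= K / 2 ^+ m * expR (g * t).
  elim: m t => [|m IH] t tT.
    rewrite expr0 divr1; apply: le_trans (hK _ tT) _.
    rewrite ler_peMr// -expR0 ler_expR mulr_ge0//; first exact: ltW.
    by move/andP: tT => [].
  rewrite exprSr invfM mulrA.
  apply: (hg _ _ (it_good m.+1) (it_good m) T) => //.
  by rewrite divr_ge0// exprn_ge0.
pose K' := K * expR (g * T).
have K'0 : 0 <= K' by rewrite mulr_ge0// expR_ge0.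
exists (2 * K') => [|m k t tT]; first by rewrite mulr_ge0.
have [t0|t0] := leP t 0.
  rewrite (it_good _).2// (it_good _).2// subrr rnorm0.
  by rewrite mulr_ge0 ?invr_ge0 ?exprn_ge0// mulr_ge0.
have step' j : rnorm (it j.+1 t - it j t) <= K' / 2 ^+ j.
  apply: le_trans (step j t _) _; first by rewrite ltW.
  rewrite /K' mulrAC ler_wpM2r ?invr_ge0 ?exprn_ge0// ler_wpM2l//.
  by rewrite ler_expR ler_pM2l.
(* The exact geometric remainder is kept so that the induction on [k] telescopes. *)
suff : rnorm (it (m + k) t - it m t) <= 2 * K' / 2 ^+ m - 2 * K' / 2 ^+ (m + k).
  move=> /le_trans; apply; rewrite lerBlDr lerDl.
  by rewrite mulr_ge0 ?invr_ge0 ?exprn_ge0// mulr_ge0.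
elim: k => [|k IH]; first by rewrite addn0 !subrr rnorm0.
rewrite addnS; apply: le_trans (rnorm_dist_trans (it (m + k) t) _ _) _.
apply: le_trans (lerD (step' _) IH) _.
rewrite addrCA lerD2l exprS invfM.
set x := (2 ^+ _)^-1; lra.
Qed.

Let lim_it t : Cn := of_crd (fun c => lim (crd c (it m t) @[m --> \oo])).

(** The tail bound makes each real coordinate a Cauchy sequence; letting the second index tend to
    infinity transfers the bound to the limit, at the cost of the norm-equivalence constants. *)
Let lim_close T : 0 <= T -> exists2 K, 0 <= K & forall m t, t <= T ->
  rnorm (lim_it t - it m t) <= K / 2 ^+ m.
Proof.
move=> T0; have [K K0 hK] := it_close T0.
have [A A0 hA] := @rnorm_le_crd R n N.
have [B B0 hB] := @crd_le_rnorm R n N.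
pose k : R := #|{: 'I_n * bool}|%:R.
have k0 : 0 <= k by [].
have cvg_it c t : t <= T -> cvg (crd c (it m t) @[m --> \oo]).
  move=> tT; apply/cauchy_cvgP/cauchyP => e e0.
  have c0 : B * K * 2^-1 ^+ m @[m --> \oo] --> (0 : R).
    by apply: cvg_geometric; rewrite ger0_norm ?invr_ge0// invf_lt1//; lra.
  have /(cvgr_lt (0 : R))/(_ e e0)[m _ hm] := c0.
  exists (crd c (it m t)); exists m => // j /= mj.
  rewrite /ball/= distrC -crdB; apply: le_lt_trans (hm m _); last by rewrite /= leqnn.
  apply: le_trans (hB _ _) _; rewrite -mulrA ler_pM2l//.
  by rewrite exprVn -(subnKC mj) hK.
exists (A * (k * (B * K))) => [|m t tT].
  by rewrite !mulr_ge0// ltW.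
apply: le_trans (hA _) _; rewrite -!mulrA ler_pM2l//.
have cle c : `|crd c (lim_it t - it m t)| <= B * (K / 2 ^+ m).
  rewrite crdB crd_of.
  have cd : `|crd c (it (m + j) t) - crd c (it m t)| @[j --> \oo] -->
      `|lim (crd c (it m t) @[m --> \oo]) - crd c (it m t)|.
    apply: cvg_norm; apply: cvgB; last exact: cvg_cst.
    have := cvg_it c t tT; rewrite -(cvg_shiftn m) => H.
    by under eq_fun do rewrite addnC.
  apply: (cvgr_to_le cd); apply: nearW => j.
  by rewrite -crdB (le_trans (hB _ _))// ler_pM2l// hK.
apply: le_trans (ler_sum _ (fun c _ => cle c)) _.
by rewrite sumr_const mulr_natl.
Qed.

Let lim_good : good lim_it.
Proof.
split=> [t|t t0]; last first.
  apply: crd_inj => c; rewrite crd_of.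
  under eq_fun do rewrite (it_good _).2//.
  exact: lim_cst.
apply/(cvg_rnormP (nbhs_filter t)) => e e0.
(* One uniform estimate must cover a neighbourhood of [t], hence the margin 1; the maximum ensures a
   nonnegative horizon. *)
have T0 : 0 <= Num.max 0 (t + 1) by rewrite le_max lexx.
have [K K0 hK] := lim_close T0.
have c0 : K * 2^-1 ^+ m @[m --> \oo] --> (0 : R).
  by apply: cvg_geometric; rewrite ger0_norm ?invr_ge0// invf_lt1//; lra.
have e30 : 0 < e / 3 by rewrite divr_gt0.
have /(cvgr_lt (0 : R))/(_ _ e30)[m _ hm] := c0.
have Km s : s < t + 1 -> rnorm (lim_it s - it m s) < e / 3.
  move=> st; apply: le_lt_trans (hm m _); last by rewrite /= leqnn.
  by rewrite exprVn hK// le_max (ltW st) orbT.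
have /(cvg_rnormP (nbhs_filter t))/(_ _ e30) := (it_good m).1 t.
have : \forall s \near t, s < t + 1 by apply: lt_nbhsl; lra.
apply: filterS2 => s st ts.
have -> : e = e / 3 + (e / 3 + e / 3) by lra.
have t1 : t < t + 1 by lra.
apply: le_lt_trans (rnorm_dist_trans (it m t) _ _) _; apply: ltrD; first exact: Km.
apply: le_lt_trans (rnorm_dist_trans (it m s) _ _) _; apply: ltrD => //.
by rewrite -rnormN opprB Km.
Qed.

(** At each [t > 0], both [picard lim_it] and [lim_it] lie within [K / 2 ^+ m / 2 * expR (g * t)] of
    the iterate [m.+1], for every [m]. *)
Let picard_lim : picard lim_it = lim_it.
Proof.
apply/funext => t; have [t0|t0] := leP t 0.
  by rewrite (picard_good lim_good).2// lim_good.2.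
have [g g0 hg] := picard_contraction.
have [K K0 hK] := lim_close (ltW t0).
apply/eqP; rewrite -subr_eq0; apply/eqP/rnorm0_eq0.
apply: (@le_geometric_eq0 _ _ (K * expR (g * t))) => [|m]; first exact: rnorm_ge0.
apply: le_trans (rnorm_dist_trans (it m.+1 t) _ _) _.
have E1 s : 0 <= s -> 1 <= expR (g * s).
  by move=> s0; rewrite -expR0 ler_expR mulr_ge0// ltW.
have H1 : rnorm (picard lim_it t - it m.+1 t) <= K / 2 ^+ m / 2 * expR (g * t).
  apply: (hg _ _ lim_good (it_good m) t) => //; last by rewrite lexx ltW.
    by rewrite divr_ge0// exprn_ge0.
  move=> s /andP[s0 st]; apply: le_trans (hK m s st) _.
  by rewrite ler_peMr ?E1// divr_ge0// exprn_ge0.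
have H2 : rnorm (it m.+1 t - lim_it t) <= K / 2 ^+ m / 2 * expR (g * t).
  rewrite -rnormN opprB; apply: le_trans (hK m.+1 t _) _ => //.
  rewrite exprSr invfM mulrA ler_peMr ?E1 ?(ltW t0)//.
  by rewrite !divr_ge0// exprn_ge0.
by apply: le_trans (lerD H1 H2) _; lra.
Qed.

Lemma solution_exists : exists w, [/\ continuous w, solution L Rop q w &
  has_initial w phi].
Proof.
exists lim_it; have [cl l0] := lim_good; split=> //.
  apply: continuous_solution => //.
  apply: (integral_solution (a := phi (I0 h) - L phi)) => //.
  by move=> t t0; rewrite -picardE// picard_lim.
by move=> s; have /andP[_ s0] := valI_itv s; rewrite l0// projIK.
Qed.

End picard.
End existence.

(** * Fubini for bounded functions and complex measures *)

(** Bounded measurable functions are stable under products and integrable over sets of finite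
    measure, which keeps the integrability conditions in Fubini arguments trivial. *)
Definition bmeas d (T : measurableType d) (R : realType) (f : T -> R) :=
  measurable_fun setT f /\ exists M, forall x, `|f x| <= M.

Section bounded_measurable.
Context d (T : measurableType d) (R : realType).
Implicit Types (f g : T -> R).

Lemma bmeas_cst (c : R) : bmeas (fun _ : T => c).
Proof. by split=> //; exists `|c|. Qed.

Lemma bmeasM f g : bmeas f -> bmeas g -> bmeas (fun x => f x * g x).
Proof.
move=> [mf [M fM]] [mg [K gK]]; split; first exact: measurable_funM.
by exists (M * K) => x; rewrite normrM ler_pM.
Qed.

Lemma bmeasD f g : bmeas f -> bmeas g -> bmeas (fun x => f x + g x).
Proof.
move=> [mf [M fM]] [mg [K gK]]; split; first exact: measurable_funD.
by exists (M + K) => x; rewrite (le_trans (ler_normD _ _))// lerD.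
Qed.

Lemma bmeasB f g : bmeas f -> bmeas g -> bmeas (fun x => f x - g x).
Proof.
move=> [mf [M fM]] [mg [K gK]]; split; first exact: measurable_funB.
by exists (M + K) => x; rewrite (le_trans (ler_normB _ _))// lerD.
Qed.

Lemma bmeas_indic f (D : set T) : measurable D -> bmeas f -> bmeas (f \_ D).
Proof.
move=> mD [mf [M fM]]; split.
  by apply/(measurable_restrictT _ mD); exact: measurable_funTS.
exists M => x; rewrite patchE; case: ifP => // _.
by rewrite normr0 (le_trans _ (fM x)).
Qed.

Lemma bmeas_comp d' (T' : measurableType d') f (g : T' -> T) :
  measurable_fun setT g -> bmeas f -> bmeas (fun x => f (g x)).
Proof.
move=> mg [mf [M fM]]; split; last by exists M.
exact: (measurableT_comp mf mg).
Qed.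

Context (mu : {measure set T -> \bar R}).

Lemma bmeas_integrable (D : set T) f : measurable D -> (mu D < +oo)%E ->
  bmeas f -> mu.-integrable D (EFin \o f).
Proof.
move=> mD Doo [mf [M fM]]; apply: measurable_bounded_integrable => //.
  exact: measurable_funTS.
exists M; split; first exact: num_real.
by move=> K MK x _; exact: le_trans (fM x) (ltW MK).
Qed.

Lemma bmeas_Rintegral_le (D : set T) f M : measurable D -> (mu D < +oo)%E ->
  measurable_fun setT f -> (forall x, `|f x| <= M) ->
  `|Rintegral mu D f| <= M * fine (mu D).
Proof.
move=> mD Doo mf fM.
have bf : bmeas f by split=> //; exists M.
have bn : bmeas (fun x => `|f x|).
  split; first exact: measurableT_comp.
  by exists M => x; rewrite normr_id.
apply: le_trans (le_normr_Rintegral mD (bmeas_integrable mD Doo bf)) _.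
rewrite -Rintegral_cst//; apply: le_Rintegral => //.
- exact: bmeas_integrable.
- exact: bmeas_integrable (bmeas_cst M).
Qed.

End bounded_measurable.

Section bounded_fubini.
Context d1 d2 (T1 : measurableType d1) (T2 : measurableType d2) (R : realType).
Context (m1 : {sigma_finite_measure set T1 -> \bar R}).
Context (m2 : {sigma_finite_measure set T2 -> \bar R}).
Context (D1 : set T1) (D2 : set T2).
Hypotheses (mD1 : measurable D1) (mD2 : measurable D2).
Hypotheses (D1oo : (m1 D1 < +oo)%E) (D2oo : (m2 D2 < +oo)%E).
Implicit Types F : T1 * T2 -> R.

Lemma bmeas_pair1 F x : bmeas F -> bmeas (fun y => F (x, y)).
Proof. by apply: bmeas_comp. Qed.

Lemma bmeas_pair2 F y : bmeas F -> bmeas (fun x => F (x, y)).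
Proof. by apply: bmeas_comp. Qed.

Lemma bmeas_Rintegral F : bmeas F ->
  bmeas (fun x => Rintegral m2 D2 (fun y => F (x, y))).
Proof.
move=> bF; have [mF [M FM]] := bF; split; last first.
  exists (M * fine (m2 D2)) => x; apply: bmeas_Rintegral_le => //.
  exact: (bmeas_pair1 x bF).1.
(* Tonelli's measurability statement concerns nonnegative functions on the whole space: [F] is
   shifted by its bound [M] and cut off outside [D2], and the shift is subtracted afterwards. *)
pose G (z : T1 * T2) := ((F z + M) * \1_D2 z.2)%:E.
have FM0 z : 0 <= F z + M.
  by have := FM z; rewrite ler_norml => /andP[]; lra.
have G0 z : (0 <= G z)%E by rewrite lee_fin mulr_ge0.
have mG : measurable_fun setT G.
  apply/measurable_EFinP; apply: measurable_funM.
    exact: measurable_funD.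
  by apply: (measurableT_comp (f := \1_D2 : T2 -> R)) => //; exact: measurable_indic.
have mI := @measurable_fun_fubini_tonelli_F _ _ _ _ _ m2 G mG G0.
have -> : (fun x => Rintegral m2 D2 (fun y => F (x, y))) =
    (fun x => fine (fubini_F m2 G x) - M * fine (m2 D2)).
  apply/funext => x; rewrite /fubini_F.
  have -> : fine (\int[m2]_y G (x, y))%E = Rintegral m2 D2 (fun y => F (x, y) + M).
    rewrite /Rintegral [in RHS]integral_mkcond; congr fine.
    apply: eq_integral => y _; rewrite /G/= patchE indicE.
    by case: ifP => _; rewrite ?mulr1 ?mulr0.
  rewrite RintegralD//.
  - by rewrite Rintegral_cst// addrK.
  - by apply: bmeas_integrable => //; exact: bmeas_pair1.
  - by apply: bmeas_integrable => //; exact: bmeas_cst.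
apply: measurable_funB => //.
exact: measurableT_comp.
Qed.

Lemma Rintegral_fubini F : bmeas F ->
  Rintegral m1 D1 (fun x => Rintegral m2 D2 (fun y => F (x, y))) =
  Rintegral m2 D2 (fun y => Rintegral m1 D1 (fun x => F (x, y))).
Proof.
move=> bF; pose D := D1 `*` D2.
have mD : measurable D by exact: measurableX.
(* Cutting [F] off outside the rectangle reduces the claim to Fubini on the full product. *)
have iF : (m1 \x m2)%E.-integrable setT ((EFin \o F) \_ D).
  apply/(integrable_mkcond _ mD); apply: bmeas_integrable => //.
  rewrite [ltLHS](product_measure1E m1 m2 mD1 mD2) -ge0_fin_numE ?mule_ge0//.
  by rewrite fin_numM// ge0_fin_numE.
have := Fubini iF.
have E1 x : (\int[m2]_y ((EFin \o F) \_ D) (x, y))%E =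
    (((fun x => (Rintegral m2 D2 (fun y => F (x, y)))%:E) \_ D1) x)%E.
  rewrite patchE; case: ifPn => xD1.
    rewrite /Rintegral fineK.
      rewrite [RHS]integral_mkcond; apply: eq_integral => y _.
      rewrite !patchE /D; congr (if _ then _ else _).
      by apply/idP/idP; rewrite !inE /=; [case|move/set_mem: xD1].
    apply: integrable_fin_num => //.
    by apply: bmeas_integrable => //; exact: bmeas_pair1.
  rewrite -[RHS](integral0 m2 setT); apply: eq_integral => y _.
  rewrite patchE ifF//; apply/negP => /set_mem[/= H _].
  by move/negP : xD1; apply; exact/mem_set.
have E2 y : (\int[m1]_x ((EFin \o F) \_ D) (x, y))%E =
    (((fun y => (Rintegral m1 D1 (fun x => F (x, y)))%:E) \_ D2) y)%E.
  rewrite patchE; case: ifPn => yD2.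
    rewrite /Rintegral fineK.
      rewrite [RHS]integral_mkcond; apply: eq_integral => x _.
      rewrite !patchE /D; congr (if _ then _ else _).
      by apply/idP/idP; rewrite !inE /=; [case|move/set_mem: yD2].
    apply: integrable_fin_num => //.
    by apply: bmeas_integrable => //; exact: bmeas_pair2.
  rewrite -[RHS](integral0 m1 setT); apply: eq_integral => x _.
  rewrite patchE ifF//; apply/negP => /set_mem[/= _ H].
  by move/negP : yD2; apply; exact/mem_set.
under eq_integral do rewrite E1.
under [in RHS]eq_integral do rewrite E2.
by rewrite -!integral_mkcond => /(congr1 fine).
Qed.

End bounded_fubini.

Section charge_integral.
Context d (T : measurableType d) (R : realType).
Implicit Types (nu : {charge set T -> \bar R}) (f g : T -> R).
Local Notation ci := charge_integral.

Lemma finite_measure_lty (m : {finite_measure set T -> \bar R}) (A : set T) :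
  measurable A -> (m A < +oo)%E.
Proof. by move=> mA; rewrite -ge0_fin_numE// fin_num_measure. Qed.

Lemma Rintegral_bounded_cvg (m : {finite_measure set T -> \bar R})
    (f_ : (T -> R)^nat) f M :
  (forall n, measurable_fun setT (f_ n)) ->
  (forall n x, `|f_ n x| <= M) -> (forall x, f_ n x @[n --> \oo] --> f x) ->
  Rintegral m setT (f_ n) @[n --> \oo] --> Rintegral m setT f.
Proof.
move=> mf_ f_M f_f.
have bf : bmeas f.
  split; first by apply: measurable_fun_cvg => // x _; exact: f_f.
  exists M => x; apply: (cvgr_to_le (cvg_norm (f_f x))).
  exact: nearW.
have moo : (m setT < +oo)%E by exact: finite_measure_lty.
have : (\int[m]_x (f_ n x)%:E @[n --> \oo] --> (Rintegral m setT f)%:E)%E.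
  rewrite /Rintegral fineK; last first.
    exact: integrable_fin_num (bmeas_integrable measurableT moo bf).
  apply: (@dominated_cvg _ _ _ m setT measurableT _ _ (cst M%:E)) => //.
  - by move=> n; apply/measurable_EFinP.
  - by move=> x _; apply: cvg_EFin; [exact: nearW|exact: f_f].
  - exact: bmeas_integrable (bmeas_cst T M).
  - by move=> n x _; rewrite lee_fin.
exact: fine_cvg.
Qed.

Lemma Rintegral_bmeasZ (m : {finite_measure set T -> \bar R}) (a : R) f :
  bmeas f -> Rintegral m setT (fun x => a * f x) = a * Rintegral m setT f.
Proof.
move=> bf; apply: RintegralZl => //; apply: bmeas_integrable => //;
  exact: finite_measure_lty.
Qed.

Lemma charge_integralZ nu (a : R) f : bmeas f ->
  ci nu (fun x => a * f x) = a * ci nu f.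
Proof. by move=> bf; rewrite /ci !Rintegral_bmeasZ//; ring. Qed.

Lemma charge_integral0 nu : ci nu (fun=> 0) = 0.
Proof.
by rewrite /ci /Rintegral !integral0 subrr.
Qed.

Lemma charge_integral_bounded_cvg nu (f_ : (T -> R)^nat) f M :
  (forall n, measurable_fun setT (f_ n)) ->
  (forall n x, `|f_ n x| <= M) -> (forall x, f_ n x @[n --> \oo] --> f x) ->
  ci nu (f_ n) @[n --> \oo] --> ci nu f.
Proof.
by move=> mf_ f_M f_f; apply: cvgB; exact: Rintegral_bounded_cvg f_f.
Qed.

Context d2 (T2 : measurableType d2).
Context (m2 : {sigma_finite_measure set T2 -> \bar R}) (D2 : set T2).
Hypotheses (mD2 : measurable D2) (D2oo : (m2 D2 < +oo)%E).
Implicit Types F : T * T2 -> R.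

Lemma bmeas_swap F : bmeas F -> bmeas (fun z : T2 * T => F (z.2, z.1)).
Proof. by apply: bmeas_comp; exact: measurable_swap. Qed.

Lemma bmeas_Rintegral_finite (m : {finite_measure set T -> \bar R}) F :
  bmeas F -> bmeas (fun y => Rintegral m setT (fun x => F (x, y))).
Proof.
move=> /bmeas_swap; apply: (bmeas_Rintegral (m2 := m)) => //.
exact: finite_measure_lty.
Qed.

Lemma bmeas_charge_integral nu F : bmeas F ->
  bmeas (fun y => ci nu (fun x => F (x, y))).
Proof. by move=> bF; apply: bmeasB; exact: bmeas_Rintegral_finite. Qed.

Lemma charge_integral_fubini nu F : bmeas F ->
  ci nu (fun x => Rintegral m2 D2 (fun y => F (x, y))) =
  Rintegral m2 D2 (fun y => ci nu (fun x => F (x, y))).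
Proof.
move=> bF; rewrite /ci RintegralB//; first last.
- exact: bmeas_integrable (bmeas_Rintegral_finite _ bF).
- exact: bmeas_integrable (bmeas_Rintegral_finite _ bF).
by congr (_ - _); apply: Rintegral_fubini => //; exact: finite_measure_lty.
Qed.

End charge_integral.

Definition cbmeas d (T : measurableType d) (R : realType) (f : T -> R[i]) :=
  bmeas (fun x => complex.Re (f x)) /\ bmeas (fun x => complex.Im (f x)).

Section complex_measure_integral.
Context d (T : measurableType d) (R : realType).
Implicit Types (mu : complex_measure T R) (f g : T -> R[i]).

Lemma cm_integral0 mu : cm_integral mu (fun=> 0) = 0.
Proof. by rewrite /cm_integral/= !charge_integral0 subrr addr0. Qed.

Lemma Re_scale (a : R) (z : R[i]) : complex.Re (a%:C * z) = a * complex.Re z.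
Proof. by case: z => u v /=; ring. Qed.

Lemma Im_scale (a : R) (z : R[i]) : complex.Im (a%:C * z) = a * complex.Im z.
Proof. by case: z => u v /=; ring. Qed.

Lemma cm_integralZ mu (a : R) f : cbmeas f ->
  cm_integral mu (fun x => a%:C * f x) = a%:C * cm_integral mu f.
Proof.
move=> [bfr bfi]; rewrite /cm_integral.
have -> : (fun x => complex.Re (a%:C * f x)) = fun x => a * complex.Re (f x).
  by apply/funext => x; rewrite Re_scale.
have -> : (fun x => complex.Im (a%:C * f x)) = fun x => a * complex.Im (f x).
  by apply/funext => x; rewrite Im_scale.
rewrite !charge_integralZ//; apply/eqP; rewrite eq_complex/=.
by apply/andP; split; apply/eqP; ring.
Qed.

Context d2 (T2 : measurableType d2).
Context (m2 : {sigma_finite_measure set T2 -> \bar R}) (D2 : set T2).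
Hypotheses (mD2 : measurable D2) (D2oo : (m2 D2 < +oo)%E).
Implicit Types F : T * T2 -> R[i].

Lemma cbmeas_cm_integral mu F : cbmeas F ->
  cbmeas (fun y => cm_integral mu (fun x => F (x, y))).
Proof.
move=> [bFr bFi]; split.
- exact: bmeasB (bmeas_charge_integral (cm_re mu) bFr)
    (bmeas_charge_integral (cm_im mu) bFi).
- exact: bmeasD (bmeas_charge_integral (cm_re mu) bFi)
    (bmeas_charge_integral (cm_im mu) bFr).
Qed.

Lemma cm_integral_fubini mu F : cbmeas F ->
  cm_integral mu (fun x => cintegral m2 D2 (fun y => F (x, y))) =
  cintegral m2 D2 (fun y => cm_integral mu (fun x => F (x, y))).
Proof.
move=> [bFr bFi]; rewrite /cm_integral /cintegral/=; congr (_ +i* _).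
- rewrite (charge_integral_fubini mD2 D2oo _ bFr).
  rewrite (charge_integral_fubini mD2 D2oo _ bFi) RintegralB//.
    exact: bmeas_integrable (bmeas_charge_integral _ bFr).
  exact: bmeas_integrable (bmeas_charge_integral _ bFi).
- rewrite (charge_integral_fubini mD2 D2oo _ bFr).
  rewrite (charge_integral_fubini mD2 D2oo _ bFi) RintegralD//.
    exact: bmeas_integrable (bmeas_charge_integral _ bFi).
  exact: bmeas_integrable (bmeas_charge_integral _ bFr).
Qed.

End complex_measure_integral.

(** * Convolutions on the half-line *)

Section reflection.
Context {R : realType}.
Local Notation mu := (@lebesgue_measure R).
Implicit Types (f g q : R -> R).

Lemma itvoo_lty (a b : R) : (mu `]a, b[ < +oo)%E.
Proof.
by rewrite lebesgue_measure_itv/=; case: ifP => // _; rewrite -EFinB ltry.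
Qed.

Local Notation T := (measurableTypeR R).
Local Notation reflect c := (fun s : T => (c - s : T)).

Lemma reflect_measurable (c : R) : measurable_fun (setT : set T) (reflect c).
Proof. exact: measurable_funB. Qed.

(** By uniqueness of Lebesgue measure it suffices to compare half-open intervals. Reflection swaps
    which endpoint is included, which leaves the length unchanged. *)
Lemma lebesgue_measure_reflect (c : R) (A : set T) : measurable A ->
  mu A = pushforward mu (reflect c) A.
Proof.
move=> mA.
have H := @lebesgue_measure_unique R (pushforward mu (reflect c)).
apply: (H (reflect_measurable c) _ A mA) => _ [[a b] _ <-].
rewrite /pushforward/=.
rewrite [X in _ = mu X](_ : _ = `[c - b, c - a[%classic); last first.
  by apply/seteqP; split=> s /=; rewrite !in_itv/=; lra.
rewrite !lebesgue_measure_itv/= !lte_fin ltrD2l ltrN2; case: ifP => // _.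
by rewrite -!EFinB; congr (_%:E); ring.
Qed.

Lemma Rintegral_reflect g (a b c : R) : bmeas g ->
  Rintegral mu `]a, b[ g = Rintegral mu `]c - b, c - a[ (fun s => g (c - s)).
Proof.
move=> bg; rewrite /Rintegral; congr fine.
have E : reflect c @^-1` `]a, b[ = `]c - b, c - a[%classic.
  by apply/seteqP; split=> s /=; rewrite !in_itv/=; lra.
have H := @eq_measure_integral _ T R `]a, b[%classic
  (pushforward mu (reflect c)).
rewrite (H (reflect_measurable c)); last first.
  by move=> A mA _; exact: lebesgue_measure_reflect.
rewrite (integral_pushforward (reflect_measurable c))//.
- by rewrite E.
- by apply/measurable_EFinP; exact: bg.1.
- rewrite E; apply: bmeas_integrable => //; first exact: itvoo_lty.
  by apply: bmeas_comp bg; exact: reflect_measurable.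
Qed.

Lemma Rintegral_translate g (a b c : R) : bmeas g ->
  Rintegral mu `]a, b[ g = Rintegral mu `]c + a, c + b[ (fun s => g (s - c)).
Proof.
move=> bg; rewrite (Rintegral_reflect a b 0 bg).
rewrite (@Rintegral_reflect (fun s => g (0 - s)) _ _ c).
  have -> : c - (0 - a) = c + a by ring.
  have -> : c - (0 - b) = c + b by ring.
  by apply: eq_Rintegral => s _; congr g; ring.
by apply: bmeas_comp bg; exact: reflect_measurable.
Qed.

Lemma Rintegral_itv_support f (a b c : R) : a <= b -> b <= c ->
  bmeas f -> (forall s, b < s -> f s = 0) ->
  Rintegral mu `]a, c[ f = Rintegral mu `]a, b[ f.
Proof.
move=> ab bc bf f0.
(* [f] may be nonzero at [b], which the left domain may contain; adding the right endpoints, which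
   are null sets, makes the two restricted integrands equal. *)
rewrite Rintegral_itv_bndo_bndc; last first.
  by apply: bmeas_integrable => //; exact: itvoo_lty.
rewrite [in RHS]Rintegral_itv_bndo_bndc; last first.
  by apply: bmeas_integrable => //; exact: itvoo_lty.
rewrite Rintegral_mkcond [RHS]Rintegral_mkcond; congr Rintegral.
apply/funext => s; rewrite !patchE !mem_setE !in_itv/=.
case: (leP s b) => sb; rewrite ?andbT ?andbF.
  by rewrite (le_trans sb bc) andbT.
by rewrite f0//; case: ifP.
Qed.

(* Both sides are the integral of [q s * g (r - s)] over the triangle
   [0 < s < r < t]. *)
Lemma convolution_primitive q g (e t : R) : 0 < t -> bmeas q -> bmeas g ->
  Rintegral mu `]0, t[ (fun s => q s * (e + Rintegral mu `]0, t - s[ g)) =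
  Rintegral mu `]0, t[
    (fun r => e * q r + Rintegral mu `]0, r[ (fun s => q s * g (r - s))).
Proof.
move=> t0 bq bg.
(* With [g] cut off at 0 the condition [s < r] is absorbed into the integrand, and the triangle
   becomes a square. *)
pose k := g \_ `]0, +oo[.
have bk : bmeas k by exact: bmeas_indic.
pose F (z : R * R) := q z.1 * k (z.2 - z.1).
have bF : bmeas F.
  apply: bmeasM; first by apply: bmeas_comp bq.
  apply: bmeas_comp bk; exact: measurable_funB.
have toy := itvoo_lty 0 t.
have E1 s : s \in `]0, t[%classic -> q s * (e + Rintegral mu `]0, t - s[ g) =
    e * q s + Rintegral mu `]0, t[ (fun r => F (s, r)).
  rewrite inE/= in_itv/= => /andP[s0 st]; rewrite mulrDr mulrC; congr (_ + _).
  rewrite (Rintegral_translate _ _ s bg) addr0 [s + _]addrC subrK.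
  rewrite -RintegralZl//; last first.
    apply: bmeas_integrable => //; first exact: itvoo_lty.
    apply: bmeas_comp bg; exact: measurable_funB.
  rewrite [RHS](Rintegral_mkcond) [LHS]Rintegral_mkcond; congr Rintegral.
  apply/funext => r; rewrite !patchE !mem_setE !in_itv/= /F/= /k patchE.
  rewrite mem_setE in_itv/= andbT subr_gt0.
  case: (ltP s r) => sr; last by rewrite mulr0; case: ifP.
  by rewrite (lt_trans s0 sr).
have E2 r : r \in `]0, t[%classic ->
    e * q r + Rintegral mu `]0, r[ (fun s => q s * g (r - s)) =
    e * q r + Rintegral mu `]0, t[ (fun s => F (s, r)).
  rewrite inE/= in_itv/= => /andP[r0 rt]; congr (_ + _).
  rewrite [RHS](Rintegral_mkcond) [LHS]Rintegral_mkcond; congr Rintegral.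
  apply/funext => s; rewrite !patchE !mem_setE !in_itv/= /F/= /k patchE.
  rewrite mem_setE in_itv/= andbT subr_gt0.
  case: (ltP s r) => sr; last by rewrite mulr0 andbF; case: ifP.
  by rewrite (lt_trans sr rt).
rewrite (@eq_Rintegral _ T R mu _ _ _ E1) (@eq_Rintegral _ T R mu _ _ _ E2).
have beq : bmeas (fun s => e * q s) by apply: bmeasM => //; exact: bmeas_cst.
rewrite [LHS]RintegralD//; last 2 first.
- exact: bmeas_integrable.
- apply: bmeas_integrable => //.
  exact: (bmeas_Rintegral (m2 := mu) (D2 := `]0, t[%classic)).
rewrite [RHS]RintegralD//; last 2 first.
- exact: bmeas_integrable.
- apply: bmeas_integrable => //.
  exact: (bmeas_Rintegral (m2 := mu) (D2 := `]0, t[%classic) _ _ (bmeas_swap bF)).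
by rewrite (@Rintegral_fubini _ _ T T R mu mu _ _ _ _ toy toy F bF).
Qed.

End reflection.

(** * Coordinate functionals and measurability from property (A) *)

Section coordinate_functional.
Context {R : realType} {n : nat} {N : cnorm R n}.
Local Notation Cn := (Cn N).

Definition coord_fun (k : 'I_n) (x : Cn) : (R[i])^o := x k 0.

Lemma coord_fun_linear k : linear (coord_fun k).
Proof. by move=> a x y; rewrite /coord_fun !mxE. Qed.

HB.instance Definition _ k :=
  GRing.isLinear.Build R[i] Cn (R[i])^o _ (coord_fun k) (coord_fun_linear k).

Lemma rnormC_le (z : (R[i])^o) :
  rnorm z <= `|complex.Re z| + `|complex.Im z|.
Proof.
case: z => a b; have -> : rnorm (a +i* b : (R[i])^o) = complex.Re `|a +i* b| by [].
rewrite normc_def/=.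
rewrite -(@ger0_norm _ (`|a| + `|b|)) ?addr_ge0// -sqrtr_sqr ler_sqrt ?sqr_ge0//.
rewrite sqrrD -!normrX !(ger0_norm (sqr_ge0 _)).
have : 0 <= `|a| * `|b| by rewrite mulr_ge0.
lra.
Qed.

Lemma coord_fun_continuous k : continuous (coord_fun k).
Proof.
move=> x; apply/(cvg_rnormP (V := (R[i])^o) (nbhs_filter x)) => e e0.
have [B B0 hB] := @crd_le_rnorm R n N.
have e1 : 0 < e / (2 * B) by rewrite divr_gt0// mulr_gt0.
have /(cvg_rnormP (nbhs_filter x))/(_ _ e1) : (y @[y --> x] --> x) by [].
apply: filterS => y; rewrite ltr_pdivlMr ?mulr_gt0// => H.
rewrite -[coord_fun k x - _](raddfB (coord_fun k)).
apply: le_lt_trans (rnormC_le _) _.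
apply: le_lt_trans (lerD (hB (k, false) (x - y)) (hB (k, true) (x - y))) _.
apply: le_lt_trans H; lra.
Qed.

Definition coord_dual (k : 'I_n) : dual Cn := MkLc (coord_fun_continuous (k := k)).

End coordinate_functional.

Section property_A_facts.
Context {R : realType} {n : nat} {N : cnorm R n} {h : {posnum R}}.
Local Notation Cn := (Cn N).
Local Notation I := (itvI h).

Lemma property_A_B_nA (phi : I -> Cn) : property_A phi -> B_nA phi.
Proof.
move=> [wm [cwm [M wM] wphi]] k.
have [C C0 hC] := Lc_bounded (coord_dual k : Lc Cn (R[i])^o).
exists (fun m t => coord_dual k (wm m t)); split.
- move=> m t; apply: (@continuous_comp I Cn (R[i])^o (wm m) (coord_dual k)).
    exact: cwm.
  exact: Lc_cts.
- by exists (C * M) => m t; rewrite (le_trans (hC _))// ler_pM2l.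
- move=> t; exact: cvg_comp (wphi t) (@Lc_cts _ _ _ (coord_dual k) (phi t)).
Qed.

(** A pointwise limit of continuous functions is Borel. Retracting the line onto [[a, b]] moves the
    approximating sequence from the subtype to the line, and its uniform bound passes to the
    limit. *)
Lemma property_A_bmeas (y : R -> Cn) (a b : R) c : a <= b ->
  property_A (fun t : set_type `[a, b]%classic => y (set_val t)) ->
  bmeas ((crd c \o y) \_ `[a, b]).
Proof.
move=> ab [wm [cwm [M wM] wy]].
have [B B0 hB] := @crd_le_rnorm R n N.
pose g t := Num.max a (Num.min t b).
have gab t : `[a, b]%classic (g t).
  by rewrite /= in_itv/= le_max lexx/= ge_max ab ge_min lexx orbT.
pose G t : set_type `[a, b]%classic := exist _ (g t) (mem_set (gab t)).
have cG : continuous G.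
  apply: continuous_to_subtype => t.
  exact: (@continuous_comp R R R (fun x => Num.min x b) (Num.max a) t
    (@minr_continuous _ b t) (@maxl_continuous _ a _)).
have bg : bmeas (fun t => crd c (y (g t))).
  split.
    apply: (@measurable_fun_cvg _ _ R setT (fun m t => crd c (wm m (G t)))).
      move=> m; apply: continuous_measurable_fun; apply: crd_continuous.
      move=> t; exact: (@continuous_comp _ _ _ G (wm m) t (cG t) (cwm m _)).
    by move=> t _; have /cvg_crdP/(_ c) := wy (G t).
  exists (B * M) => t.
  have /cvg_crdP/(_ c)/cvg_norm H := wy (G t).
  apply: (cvgr_to_le H); apply: nearW => m.
  by rewrite (le_trans (hB _ _))// ler_pM2l.
have -> : (crd c \o y) \_ `[a, b] = (fun t => crd c (y (g t))) \_ `[a, b].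
  apply/funext => t; rewrite !patchE mem_setE in_itv/=; case: ifP => // /andP[ta tb].
  by rewrite /g /= min_l// max_r.
exact: bmeas_indic.
Qed.

Local Notation borelI := (g_sigma_algebraType (@open I)).

Lemma valI_measurable : measurable_fun (setT : set borelI) (@valI R h : borelI -> R).
Proof.
apply: (measurability _ (RGenOpens.measurableE R)) => _ [_ [a [b ->]] <-].
apply: sub_sigma_algebra; rewrite setTI.
have /continuousP := @valI_continuous R h; apply.
exact: interval_open.
Qed.

End property_A_facts.

(** * Continuity of causal convolutions *)

Section convolution.
Context {R : realType}.
Local Notation mu := (@lebesgue_measure R).
Local Notation T := (measurableTypeR R).
Implicit Types (q x : R -> R).

Definition causal_conv q x (t : R) : R :=
  if 0 < t then Rintegral mu `]0, t[ (fun s => q s * x (t - s)) else 0.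

Definition proj_itv (a b s : R) : R := Num.max a (Num.min s b).

Lemma proj_itv_continuous a b : continuous (proj_itv a b).
Proof.
have -> : proj_itv a b = Num.max a \o (fun s : R => Num.min s b) by [].
move=> t; have := @continuous_comp R R R (fun s : R => Num.min s b) (Num.max a) t
    (@minr_continuous _ b t) (@maxl_continuous _ a _).
exact.
Qed.

Lemma proj_itvE a b s : a <= s <= b -> proj_itv a b s = s.
Proof. by move=> /andP[sa sb]; rewrite /proj_itv min_l// max_r. Qed.

Lemma proj_itv_in a b s : a <= b -> a <= proj_itv a b s <= b.
Proof. by move=> ab; rewrite le_max lexx/= ge_max ab ge_min lexx orbT. Qed.

Lemma comp_continuous q (f : R -> R) : continuous q -> continuous f ->
  continuous (q \o f).
Proof. by move=> cq cf t; apply: continuous_comp; [exact: cf|exact: cq]. Qed.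

Lemma bmeas_proj_itv q (a b : R) : a <= b -> continuous q ->
  bmeas (q \o proj_itv a b).
Proof.
move=> ab cq; split.
  apply: continuous_measurable_fun.
  exact: (comp_continuous cq (@proj_itv_continuous a b)).
have cn : continuous (fun s => `|q s|).
  by move=> s; apply: cvg_norm; exact: cq.
have [c _ hc] := EVT_max ab (continuous_subspaceT cn).
by exists `|q c| => s; apply: hc; rewrite in_itv/= proj_itv_in.
Qed.

Lemma Rintegral_primitive_continuous (z : R -> R) (t : R) :
  bmeas z -> (forall s : R, s < 0 -> z s = 0) ->
  {for t, continuous (fun t : R => Rintegral mu `]0, t[ z)}.
Proof.
move=> bz z0; pose K := `|t| + 1.
have tK : - K < t < K.
  have : `|t| < K by rewrite /K; lra.
  by rewrite ltr_norml.
have K0 : 0 <= K by rewrite addr_ge0.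
have zi (A : set T) (a b : R) : measurable A -> A `<=` `[a, b] ->
    mu.-integrable A (EFin \o z).
  move=> mA Aab; apply: bmeas_integrable => //.
  apply: (@le_lt_trans _ _ (mu `[a, b])).
    exact: le_measure (mem_set _) (mem_set _) _.
  by rewrite lebesgue_measure_itv/=; case: ifP => // _; rewrite -EFinB ltry.
(* Since [z] vanishes to the left of 0, the integral may start at [- K]; it is then a primitive with
   fixed base point and [t] in the interior of [[- K, K]]. *)
have E s : Rintegral mu `]0, s[ z = Rintegral mu `[- K, s] z.
  rewrite Rintegral_itv_bndo_bndc; last first.
    by apply: (zi _ 0 s) => //; apply: subset_itv; rewrite bnd_simp.
  rewrite Rintegral_itv_obnd_cbnd; last first.
    by apply: (zi _ 0 s) => //; apply: subset_itv; rewrite bnd_simp.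
  rewrite Rintegral_mkcond [RHS]Rintegral_mkcond; congr Rintegral.
  apply/funext => r; rewrite !patchE !mem_setE !in_itv/=.
  have [r0|r0] := leP 0 r; last by rewrite z0//; case: ifP.
  by rewrite (le_trans _ r0)// oppr_le0.
under [X in {for t, continuous X}]eq_fun do rewrite E.
have iz : mu.-integrable `[- K, K] (EFin \o z) by apply: (zi _ (- K) K).
have := parameterized_integral_continuous (_ : - K <= K) iz.
have KK : - K <= K by lra.
move=> /(_ KK) /(continuous_within_itvP _ (lt_trans (andP tK).1 (andP tK).2)) [+ _ _].
by apply; rewrite in_itv.
Qed.

(** [x] is merely bounded and measurable on compact intervals, so a reflection puts [t] into [q].
    Subtracting [q 0] makes [q0] vanish on the negative half-line, so the domain can be fixed to
    []0, b[] and dominated convergence applies; the subtracted part is a multiple of a primitive. *)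
Lemma causal_conv_continuous q x : continuous q ->
  (forall b, bmeas (x \_ `[0, b])) -> continuous (causal_conv q x).
Proof.
move=> cq bx t0.
pose b := `|t0| + 1; have b0 : 0 <= b by rewrite addr_ge0.
have t0b : t0 < b by have := ler_norm t0; rewrite /b; lra.
pose z := x \_ `[0, b].
have bz : bmeas z by exact: bx.
have [_ [M zM]] := bz.
have M0 : 0 <= M by exact: le_trans (zM 0).
pose qb := q \o proj_itv 0 b.
have bq : bmeas qb by exact: bmeas_proj_itv.
have cqb : continuous qb by exact: (comp_continuous cq (@proj_itv_continuous 0 b)).
pose q0 s := qb s - q 0.
have q00 s : s <= 0 -> q0 s = 0.
  by move=> s0; rewrite /q0 /qb/= /proj_itv max_l ?subrr// ge_min s0.
have bq0 : bmeas q0 by apply: bmeasB => //; exact: bmeas_cst.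
have cq0 : continuous q0 by move=> s; apply: cvgB; [exact: cqb|exact: cvg_cst].
have boo := itvoo_lty 0 b.
have bmz (t : R) : bmeas (fun s : T => q0 (t - s) * z s).
  by apply: bmeasM bz; apply: bmeas_comp bq0; exact: reflect_measurable.
pose Phi t := Rintegral mu `]0, b[ (fun s => q0 (t - s) * z s)
  + q 0 * Rintegral mu `]0, t[ z.
have convE t : t < b -> causal_conv q x t = Phi t.
  move=> tb; rewrite /causal_conv /Phi; case: ifPn => [tpos|]; last first.
    rewrite -leNgt => tneg.
    rewrite [X in _ = X + _](_ : _ = 0); last first.
      rewrite -[RHS](Rintegral_set0 mu (fun=> 0)).
      rewrite Rintegral_mkcond [RHS]Rintegral_mkcond.
      congr Rintegral; apply/funext => s; rewrite !patchE in_set0 mem_setE in_itv/=.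
      by case: ifP => // /andP[s0 _]; rewrite q00 ?mul0r//; lra.
    by rewrite set_itv_ge ?Rintegral_set0 ?mulr0 ?addr0// bnd_simp -leNgt.
  have too := itvoo_lty 0 t.
  have bqz : bmeas (fun s : T => qb s * z (t - s)).
    by apply: bmeasM bq _; apply: bmeas_comp bz; exact: reflect_measurable.
  transitivity (Rintegral mu `]0, t[ (fun s => qb s * z (t - s))).
    rewrite Rintegral_mkcond [RHS]Rintegral_mkcond; congr Rintegral.
    apply/funext => s; rewrite !patchE mem_setE in_itv/=; case: ifP => // /andP[s0 st].
    rewrite /qb/= proj_itvE; last by lra.
    by rewrite /z patchE mem_setE in_itv/= ifT//; lra.
  rewrite (Rintegral_reflect 0 t t bqz) subrr subr0.
  transitivity (Rintegral mu `]0, t[ (fun s => q0 (t - s) * z s + q 0 * z s)).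
    by apply: eq_Rintegral => s _; rewrite /q0 -mulrDl subrK; congr (_ * z _); ring.
  rewrite RintegralD//; last 2 first.
  - exact: bmeas_integrable.
  - by apply: bmeas_integrable => //; apply: bmeasM bz; exact: bmeas_cst.
  rewrite RintegralZl//; last exact: bmeas_integrable.
  congr (_ + _); rewrite -(@Rintegral_itv_support _ _ 0 t b)//.
  - exact: ltW.
  - exact: ltW.
  - exact: bmz.
  - by move=> s ts; rewrite q00 ?mul0r//; lra.
have cPhi : {for t0, continuous Phi}.
  apply: cvgD; last first.
    apply: cvgM; first exact: cvg_cst.
    apply: Rintegral_primitive_continuous => // s s0.
    by rewrite /z patchE mem_setE in_itv/= leNgt s0.
  have [_ [Q q0Q]] := bq0.
  suff : {in `]t0 - 1, t0 + 1[%classic, continuous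
      (fun t : R => Rintegral mu `]0, b[ (fun s : T => q0 (t - s) * z s))}.
    by apply; rewrite inE/= in_itv/=; lra.
  apply: (@continuity_under_integral _ _ _ _ _ _ _ _ _ _ _ (fun=> Q * M)) => //.
  - move=> t _; exact: (@bmeas_integrable _ T R mu _ _ _ _ (bmz t)).
  - apply: aeW => s _ t _; apply: cvgM; last exact: cvg_cst.
    apply: (@continuous_comp R R R (fun t => t - s) q0); last exact: cq0.
    by apply: cvgB => //; exact: cvg_cst.
  - by apply: bmeas_integrable => //; exact: bmeas_cst.
  - by move=> t _; apply: aeW => s _; rewrite normrM ler_pM.
rewrite /continuous_at convE//.
apply: cvg_trans cPhi; apply: near_eq_cvg; near=> t.
by rewrite convE//; near: t; exact: lt_nbhsl.
Unshelve. all: by end_near. Qed.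

End convolution.

(** * The extension of a functional along the fundamental solution *)

Section riesz.
Context {R : realType} {n : nat} {N : cnorm R n} {h : {posnum R}}.
Local Notation Cn := (Cn N).
Local Notation I := (itvI h).
Local Notation C_cn := (contI h Cn).
Local Notation borelI := (g_sigma_algebraType (@open I)).

Lemma comp_fun_cts (psi : C_cn) (k : 'I_n) :
  (fun s => psi s k 0 : (R[i])^o) \in @cts_pred R h (R[i])^o.
Proof.
apply/cts_predP => s.
have /cts_predP cpsi := contI_cts psi.
exact: (@continuous_comp I Cn (R[i])^o psi (coord_fun k) s (cpsi s)
  (@coord_fun_continuous _ _ _ k (psi s))).
Qed.

(** Riesz measures are prescribed on functions with a single component only, so [psi] is split into
    its embedded components. *)
Lemma riesz_measuresE (lambda : dual C_cn) (mu : 'I_n -> complex_measure borelI R)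
    (psi : C_cn) : riesz_measures lambda mu ->
  lambda psi = lambda_e mu psi.
Proof.
move=> hmu; pose chi k := ContI (comp_fun_cts psi k).
have psiE : psi = \sum_k (embed k (chi k) : C_cn).
  apply: contI_eq => s.
  have -> : (\sum_k (embed k (chi k) : C_cn)) s = \sum_k (embed k (chi k) s : Cn).
    by elim/big_ind2: _ => // _ x _ y <- <-.
  rewrite [LHS](matrix_sum_delta (psi s : 'cV_n)); apply: eq_bigr => k _.
  by rewrite big_ord1.
rewrite [in LHS]psiE linear_sum/=; apply: eq_bigr => k _.
by rewrite (hmu k).2.
Qed.

Lemma Lc_compE (Y : normedModType R[i]) (g : dual Y) (f : Lc C_cn Y) psi :
  Lc_comp g f psi = g (f psi).
Proof. by []. Qed.

Definition hat_fun (m : nat) (s : I) : R := Num.max 0 (1 + m%:R * valI s).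

Lemma hat_fun_cts m :
  (fun s => (hat_fun m s)%:C : (R[i])^o) \in @cts_pred R h (R[i])^o.
Proof.
have ch : continuous (hat_fun m).
  move=> s; apply: (@continuous_comp I R R (fun s => 1 + m%:R * valI s) (Num.max 0)).
    apply: (cvgD (cvg_cst _ (FF := nbhs_filter s))).
    exact: (cvgM (cvg_cst _ (FF := nbhs_filter s)) (@valI_continuous _ _ s)).
  exact: maxl_continuous.
apply/cts_predP => s.
apply/(cvg_rnormP (V := (R[i])^o) (nbhs_filter s)) => e e0.
have /(@cvgrPdist_lt _ _ _ (nbhs s) (nbhs_filter s))/(_ e e0) := ch s.
apply: filterS => t; apply: le_lt_trans.
rewrite -[X in rnorm X](rmorphB (real_complex R)).
by apply: le_trans (rnormC_le _) _; rewrite /= normr0 addr0.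
Qed.

(* The hat functions are supported in [-1/m, 0] and decrease to the indicator
   of {0}, so [L] vanishes on them for large m. *)
Lemma extension_phi0 (L : Lc C_cn Cn) LE (j : 'I_n) (ystar : dual Cn) :
  Delta_cond L -> is_extension L LE -> B_nA (phi_ (N := N) (h := h) j) ->
  LE (phi_ j) ystar = 0.
Proof.
move=> [D /andP[D0 Dh] LD] HLE Bphi; have [mu hmu LEE] := HLE ystar.
rewrite LEE// /lambda_e (bigD1 j)//= big1 ?addr0 => [|k kj]; last first.
  rewrite -[RHS](cm_integral0 (mu k)); congr cm_integral.
  apply/funext => s; rewrite /phi_; case: ifP => _; last by rewrite mxE.
  by rewrite mxE (negbTE kj).
pose ind (s : borelI) : R := (valI s == 0)%:R.
have -> : (fun t => phi_ (N := N) (h := h) j t j 0) = (fun s => (ind s)%:C).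
  apply/funext => s; rewrite /phi_ /ind; case: ifP => _; last by rewrite mxE.
  by rewrite mxE !eqxx.
have hb m s : 0 <= hat_fun m s <= 1.
  rewrite /hat_fun le_max lexx/= ge_max ler01/= gerDl.
  by rewrite mulr_ge0_le0//; have /andP[] := valI_itv s.
have cvg_hat nu : charge_integral nu (hat_fun m : borelI -> R) @[m --> \oo] -->
    charge_integral nu ind.
  apply: (@charge_integral_bounded_cvg _ _ _ _ _ _ 1).
  - move=> m; apply: (measurable_comp (F := setT)
      (f := fun x : R => Num.max 0 (1 + m%:R * x))) => //.
      apply: continuous_measurable_fun.
      apply: (@comp_continuous _ (Num.max 0) (fun x => 1 + m%:R * x)).
        exact: maxl_continuous.
      by move=> x; apply: cvgD; [exact: cvg_cst|apply: cvgM => //; exact: cvg_cst].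
    exact: valI_measurable.
  - by move=> m s; have /andP[s0 s1] := hb m s; rewrite ger0_norm.
  - move=> s; rewrite /ind; have [s0|s0] := eqVneq (valI s) 0.
      apply: cvg_near_cst; apply: nearW => m.
      by rewrite /hat_fun s0 mulr0 addr0 max_r.
    have sneg : valI s < 0 by have /andP[_] := valI_itv s; rewrite le_eqVlt (negbTE s0).
    apply: cvg_near_cst; near=> m.
    rewrite /hat_fun max_l//.
    have : (- valI s)^-1 <= m%:R by near: m; exact: nbhs_infty_ger.
    by rewrite -div1r ler_pdivrMr ?oppr_gt0// mulrN; lra.
pose hat m : contI h (R[i])^o := ContI (hat_fun_cts m).
have hat0 : \forall m \near \oo,
    charge_integral (cm_re (mu j)) (hat_fun m : borelI -> R) = 0 /\
    charge_integral (cm_im (mu j)) (hat_fun m : borelI -> R) = 0.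
  near=> m.
  have Lhat : L (embed j (hat m)) = 0.
    apply: LD => s sD /=; rewrite /embed_fun /= /hat_fun max_l ?scale0r//.
    have : D^-1 <= m%:R by near: m; exact: nbhs_infty_ger.
    rewrite -div1r ler_pdivrMr// => mD.
    have : m%:R * valI s <= m%:R * - D by rewrite ler_wpM2l.
    by rewrite mulrN; lra.
  (* The hats are real, so the vanishing complex integral splits into one equation for the real
     charge and one for the imaginary charge. *)
  have := (hmu j).2 (hat m); rewrite Lc_compE Lhat linear0.
  move=> /esym/eqP; rewrite eq_complex/= /cm_integral/= !charge_integral0.
  by rewrite subr0 add0r => /andP[/eqP -> /eqP ->].
have ci0 nu : (\forall m \near \oo, charge_integral nu (hat_fun m : borelI -> R) = 0) ->
    charge_integral nu ind = 0.
  move=> H; apply: (cvg_unique (@Rhausdorff R) (cvg_hat nu)).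
  exact: cvg_near_cst.
rewrite /cm_integral/= !charge_integral0 subr0 add0r.
by rewrite !ci0//; apply: filterS hat0 => m [].
Unshelve. all: by end_near. Qed.

End riesz.

Section complex_integral_sum.
Context d (T : measurableType d) (R : realType).
Context (m : {measure set T -> \bar R}) (D : set T).
Hypotheses (mD : measurable D) (Doo : (m D < +oo)%E).
Implicit Types f g : T -> R[i].

Lemma cbmeas0 : cbmeas (fun _ : T => 0 : R[i]).
Proof. by split; exact: bmeas_cst. Qed.

Lemma cbmeasD f g : cbmeas f -> cbmeas g -> cbmeas (fun x => f x + g x).
Proof.
move=> [fr fi] [gr gi]; split.
- have -> : (fun x => complex.Re (f x + g x)) =
    (fun x => complex.Re (f x) + complex.Re (g x)).
    by apply/funext => x; rewrite raddfD.
  exact: bmeasD.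
- have -> : (fun x => complex.Im (f x + g x)) =
    (fun x => complex.Im (f x) + complex.Im (g x)).
    by apply/funext => x; rewrite raddfD.
  exact: bmeasD.
Qed.

Lemma cbmeasZ (a : T -> R) f : bmeas a -> cbmeas f ->
  cbmeas (fun x => (a x)%:C * f x).
Proof.
move=> ba [fr fi]; split.
- have -> : (fun x => complex.Re ((a x)%:C * f x)) =
    (fun x => a x * complex.Re (f x)) by apply/funext => x; rewrite Re_scale.
  exact: bmeasM.
- have -> : (fun x => complex.Im ((a x)%:C * f x)) =
    (fun x => a x * complex.Im (f x)) by apply/funext => x; rewrite Im_scale.
  exact: bmeasM.
Qed.

Lemma cbmeas_comp d' (T' : measurableType d') (g : T' -> T) f :
  measurable_fun setT g -> cbmeas f -> cbmeas (fun x => f (g x)).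
Proof.
by move=> mg [fr fi]; split;
  [exact: (bmeas_comp mg fr)|exact: (bmeas_comp mg fi)].
Qed.

Lemma cintegral0 : cintegral m D (fun=> 0) = 0.
Proof. by rewrite /cintegral /Rintegral !integral0. Qed.

Lemma cintegralD f g : cbmeas f -> cbmeas g ->
  cintegral m D (fun x => f x + g x) = cintegral m D f + cintegral m D g.
Proof.
move=> [fr fi] [gr gi]; apply/eqP; rewrite eq_complex/=; apply/andP; split; apply/eqP.
- under eq_Rintegral do rewrite raddfD.
  by apply: RintegralD => //; exact: bmeas_integrable.
- under eq_Rintegral do rewrite raddfD.
  by apply: RintegralD => //; exact: bmeas_integrable.
Qed.

Lemma cintegral_sum (J : Type) (r : seq J) (f : J -> T -> R[i]) :
  (forall i, cbmeas (f i)) ->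
  cbmeas (fun x => \sum_(i <- r) f i x) /\
  cintegral m D (fun x => \sum_(i <- r) f i x) = \sum_(i <- r) cintegral m D (f i).
Proof.
move=> bf; elim: r => [|i r [bs IH]].
  have -> : (fun x => \sum_(i <- [::]) f i x) = fun=> 0.
    by apply/funext => x; rewrite big_nil.
  by rewrite big_nil cintegral0; split=> //; exact: cbmeas0.
have -> : (fun x => \sum_(i <- i :: r) f i x) =
    (fun x => f i x + \sum_(i <- r) f i x).
  by apply/funext => x; rewrite big_cons.
by rewrite big_cons cintegralD// IH; split=> //; exact: cbmeasD.
Qed.

End complex_integral_sum.

(** * Functionals applied to segments of a convolution *)

Section extension_convolution.
Context {R : realType} {n : nat} {N : cnorm R n} {h : {posnum R}}.
Local Notation Cn := (Cn N).
Local Notation I := (itvI h).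
Local Notation C_cn := (contI h Cn).
Local Notation borelI := (g_sigma_algebraType (@open I)).
Local Notation mu := (@lebesgue_measure R).
Context (M : Lc C_cn Cn) (ME : (I -> Cn) -> dual Cn -> R[i]).
Hypothesis HM : is_extension M ME.
Context (x : R -> Cn) (q : R -> R) (P : R -> Cn) (t : R).
Hypotheses (bx : forall c, bmeas (crd c \o x)).
Hypotheses (x0 : forall s, s < 0 -> x s = 0) (bq : bmeas q).
Hypothesis (cP : continuous P).
Hypothesis PE : forall s c, s <= t ->
  crd c (P s) = Rintegral mu `]0, t[ (fun r => q r * crd c (x (s - r))).
Hypothesis xB : forall s, 0 < s < t -> B_nA (seg x s : I -> Cn).

(* [G] extends [s |-> ME (seg x s) (coord_dual k)] to all real [s]. *)
Lemma extension_convolution (k : 'I_n) : exists G : R -> R[i],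
  [/\ cbmeas G,
      forall s, 0 < s < t -> ME (seg x s) (coord_dual k) = G s &
      forall s, 0 < s <= t -> forall b : bool, crd (k, b) (M (cseg P s)) =
        causal_conv q (fun r => if b then complex.Im (G r) else complex.Re (G r)) s].
Proof.
have [nu hnu MEE] := HM (coord_dual k).
pose G s := lambda_e nu (seg x s).
have bxi i : cbmeas (fun s => x s i 0).
  by split; [exact: (bx (i, false))|exact: (bx (i, true))].
have toy := itvoo_lty 0 t.
pose H i s := cm_integral (nu i) (fun u => x (s + valI u) i 0).
have bH i : cbmeas (H i).
  apply: (cbmeas_cm_integral (nu i)
    (F := fun z : borelI * R => x (z.2 + valI z.1) i 0)).
  apply: (cbmeas_comp (g := fun z : borelI * R => z.2 + valI z.1)) (bxi i).
  apply: measurable_funD => //.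
  exact: (measurableT_comp (@valI_measurable R h) measurable_fst).
have bG : cbmeas G.
  by have [] := @cintegral_sum _ (measurableTypeR R) R mu _ (measurable_itv _) toy _ (index_enum 'I_n) _ bH.
exists G; split=> [//|s st|s /andP[s0 st] b]; first by rewrite MEE//; exact: xB.
have mr : measurable_fun setT (fun r : R => s - r) by exact: reflect_measurable.
(* The convolution integral in [PE] runs over the fixed interval []0, t[], so Fubini can interchange
   it with the Riesz measures; what remains inside at [r] is the extension applied to the segment of
   [x] at [s - r]. *)
have E : coord_dual k (M (cseg P s)) =
    cintegral mu `]0, t[ (fun r => (q r)%:C * G (s - r)).
  rewrite -Lc_compE (riesz_measuresE _ hnu) /lambda_e.
  transitivity (\sum_i cintegral mu `]0, t[ (fun r => (q r)%:C * H i (s - r))).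
    apply: eq_bigr => i _.
    pose F (z : borelI * R) := (q z.2)%:C * x (s + valI z.1 - z.2) i 0.
    have bF : cbmeas F.
      apply: cbmeasZ; first exact: (bmeas_comp _ bq).
      apply: (cbmeas_comp (g := fun z : borelI * R => s + valI z.1 - z.2)) (bxi i).
      apply: measurable_funB => //; apply: measurable_funD => //.
      exact: (measurableT_comp (@valI_measurable R h) measurable_fst).
    transitivity (cm_integral (nu i)
      (fun u => cintegral mu `]0, t[ (fun r => F (u, r)))).
      congr cm_integral; apply/funext => u; rewrite csegE//.
      have su : s + valI u <= t by have := valI_itv u; lra.
      apply/eqP; rewrite eq_complex; apply/andP; split; apply/eqP.
        rewrite [LHS](PE (i, false) su); apply: eq_Rintegral => r _.
        by rewrite Re_scale.
      rewrite [LHS](PE (i, true) su); apply: eq_Rintegral => r _.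
      by rewrite Im_scale.
    rewrite (cm_integral_fubini (m2 := mu) (measurable_itv _) toy _ bF).
    congr cintegral; apply/funext => r; rewrite /F/= -cm_integralZ; last first.
      apply: (cbmeas_comp (g := fun u : borelI => s - r + valI u)) (bxi i).
      by apply: measurable_funD => //; exact: valI_measurable.
    congr cm_integral; apply/funext => u; congr (_ * x _ _ _); ring.
  have bqH i : cbmeas (fun r => (q r)%:C * H i (s - r)).
    by apply: cbmeasZ => //; exact: (cbmeas_comp mr (bH i)).
  have [_ S] := @cintegral_sum _ (measurableTypeR R) R mu _ (measurable_itv _)
    toy _ (index_enum 'I_n) _ bqH.
  rewrite -[LHS]S.
  by congr cintegral; apply/funext => r; rewrite -mulr_sumr.
(* Negative times contribute nothing, so the integral over []0, t[] stops at [s]. *)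
have Gneg r : r < 0 -> G r = 0.
  move=> r0; rewrite /G /lambda_e big1// => i _.
  rewrite -[RHS](cm_integral0 (nu i)); congr cm_integral; apply/funext => u.
  by rewrite /seg x0 ?mxE//; have := valI_itv u; lra.
have -> : crd (k, b) (M (cseg P s)) = if b then complex.Im (coord_dual k (M (cseg P s)))
  else complex.Re (coord_dual k (M (cseg P s))) by [].
rewrite E /causal_conv s0 /cintegral/=; case: b.
- transitivity (Rintegral mu `]0, t[ (fun r => q r * complex.Im (G (s - r)))).
    by apply: eq_Rintegral => r _; rewrite Im_scale.
  apply: Rintegral_itv_support => //; first exact: ltW.
    by apply: bmeasM => //; exact: (bmeas_comp mr bG.2).
  by move=> r sr; rewrite Gneg ?mulr0//; lra.
- transitivity (Rintegral mu `]0, t[ (fun r => q r * complex.Re (G (s - r)))).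
    by apply: eq_Rintegral => r _; rewrite Re_scale.
  apply: Rintegral_itv_support => //; first exact: ltW.
    by apply: bmeasM => //; exact: (bmeas_comp mr bG.1).
  by move=> r sr; rewrite Gneg ?mulr0//; lra.
Qed.

End extension_convolution.

(** * Columns of the fundamental solution *)

Section column.
Context {R : realType} {n : nat} {N : cnorm R n} {h : {posnum R}}.
Local Notation Cn := (Cn N).
Local Notation I := (itvI h).
Local Notation C_cn := (contI h Cn).
Local Notation mu := (@lebesgue_measure R).
Context (L Rop : Lc C_cn Cn) (HL : Delta_cond L) (j : 'I_n).

Definition vconv (q : R -> R) (x : R -> Cn) (t : R) : Cn :=
  of_crd (fun c => causal_conv q (crd c \o x) t).

Lemma vconv_le0 q x (t : R) : t <= 0 -> vconv q x t = 0.
Proof.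
move=> t0; apply: crd_inj => c; rewrite crd_of crd0 /causal_conv.
by rewrite ltNge t0.
Qed.

Context (y : R -> Cn) (Hy : extended_solution L Rop (phi_ j) y).
(** [y] is arbitrary to the left of [-h]; cutting at 0 matches the column of [X] and loses nothing,
    as [phi_ j] vanishes on [[-h, 0[]. *)
Let x (t : R) : Cn := if t < 0 then 0 else y t.

Let y_neg s : - h%:num <= s -> s < 0 -> y s = 0.
Proof.
move=> hs s0; have [LE [RE [_ _ [y0 _ _ _ _]]]] := Hy.
have sI : - h%:num <= s <= 0 by rewrite hs ltW.
have := y0 (projI s); rewrite valI_projI_in// => ->.
by rewrite /phi_ valI_projI_in// lt_eqF.
Qed.

Lemma column_bmeas b c : bmeas ((crd c \o x) \_ `[0, b]).
Proof.
have [LE [RE [_ _ [_ yA _ _ _]]]] := Hy.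
have [b0|b0] := leP 0 b.
  have -> : (crd c \o x) \_ `[0, b] = (crd c \o y) \_ `[0, b].
    apply/funext => s; rewrite !patchE mem_setE in_itv/=; case: ifP => // /andP[s0 _].
    by rewrite /x ltNge s0.
  by apply: property_A_bmeas => //; apply: yA; rewrite ?oppr_le0.
have -> : (crd c \o x) \_ `[0, b] = fun=> 0.
  by apply/funext => s; rewrite patchE mem_setE in_itv/=; case: ifP => //; lra.
exact: bmeas_cst.
Qed.

(** The cut-off replaces [y] by a function bounded on the whole line, as Fubini asks; these segments
    do not notice it because [y] vanishes on [[-h, 0[]. *)
Let seg_cut s t : 0 < s < t ->
  seg (fun r => if 0 <= r <= t then y r else 0) s = seg y s :> (I -> Cn).
Proof.
move=> /andP[s0 st]; apply/funext => u; rewrite /seg; have uI := valI_itv u.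
have [su|su] := leP 0 (s + valI u); first by rewrite ifT//=; lra.
by rewrite y_neg//; lra.
Qed.

Section scalar.
Context (q : R -> R) (cq : continuous q).
Let P := vconv q x.

Lemma vconv_continuous : continuous P.
Proof.
move=> t; apply/cvg_crdP => c; rewrite /P /vconv crd_of.
have -> : (fun s => crd c (vconv q x s)) = causal_conv q (crd c \o x).
  by apply/funext => s; rewrite crd_of.
by apply: causal_conv_continuous => // b; exact: column_bmeas.
Qed.

(** The summand 0 is the constant of integration expected by [integral_solution]. One [t] and one
    real coordinate are treated at a time, so that bounded substitutes agreeing on [[0, t]]
    suffice. *)
Let column_equation t : 0 <= t ->
  P t - L (cseg P t) =
    0 + cprim (fun s => Rop (cseg P s) + (q s)%:C *: (delta_mx j 0 : Cn)) t.
Proof.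
rewrite le_eqVlt add0r => /predU1P[<-|t0].
  rewrite cprim0 /P vconv_le0// (_ : cseg _ 0 = 0 :> C_cn) ?[L 0]linear0 ?subr0//.
  apply: contI_eq => s; rewrite csegE; last exact: vconv_continuous.
  by rewrite add0r vconv_le0//; have := valI_itv s; lra.
have [LE [RE [HLE HRE [y0 yA ysA _ yE]]]] := Hy.
pose xt s : Cn := if 0 <= s <= t then y s else 0.
pose qt := q \o proj_itv 0 t.
have bqt : bmeas qt by apply: bmeas_proj_itv => //; exact: ltW.
have bxt c : bmeas (crd c \o xt).
  rewrite (_ : crd c \o xt = (crd c \o x) \_ `[0, t]); first exact: column_bmeas.
  apply/funext => s; rewrite patchE mem_setE in_itv/= /xt /=.
  by case: ifP => [/andP[s0 _]|_]; rewrite ?crd0// /x ltNge s0.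
have xt0 s : s < 0 -> xt s = 0 by move=> s0; rewrite /xt leNgt s0.
have mr (s : R) : measurable_fun setT (fun r : R => s - r) by exact: reflect_measurable.
have PE s c : s <= t ->
    crd c (P s) = Rintegral mu `]0, t[ (fun r => qt r * crd c (xt (s - r))).
  move=> st; rewrite /P /vconv crd_of /causal_conv; case: ifPn => [s0|].
    rewrite (@Rintegral_itv_support _ _ 0 s t)//; first last.
    - by move=> r sr; rewrite xt0 ?crd0 ?mulr0//; lra.
    - by apply: bmeasM => //; exact: (bmeas_comp (mr s) (bxt c)).
    - exact: ltW.
    rewrite Rintegral_mkcond [RHS]Rintegral_mkcond; congr Rintegral.
    apply/funext => r; rewrite !patchE mem_setE in_itv/=; case: ifP => // /andP[r0 rs].
    rewrite /qt /= proj_itvE; last by lra.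
    rewrite /x /xt ifF; last by apply/negbTE; rewrite -leNgt; lra.
    by rewrite ifT//; lra.
  rewrite -leNgt => s0; rewrite -[LHS](Rintegral_set0 mu (fun=> 0)).
  rewrite Rintegral_mkcond [RHS]Rintegral_mkcond; congr Rintegral.
  apply/funext => r; rewrite !patchE in_set0 mem_setE in_itv/=.
  by case: ifP => // /andP[r0 _]; rewrite xt0 ?crd0 ?mulr0//; lra.
have xB s : 0 < s < t -> B_nA (seg xt s : I -> Cn).
  by move=> st; rewrite seg_cut//; apply/property_A_B_nA/ysA; lra.
apply: crd_inj => -[k b].
have cP := vconv_continuous.
have [GL [bGL GLE LP]] := extension_convolution HLE bxt xt0 bqt cP PE xB k.
have [GR [bGR GRE RP]] := extension_convolution HRE bxt xt0 bqt cP PE xB k.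
pose part (z : R[i]) := if b then complex.Im z else complex.Re z.
have bl : bmeas (part \o GL) by rewrite /part; case: (b); [exact: bGL.2|exact: bGL.1].
have br : bmeas (part \o GR) by rewrite /part; case: (b); [exact: bGR.2|exact: bGR.1].
pose e := crd (k, b) (delta_mx j 0 : Cn).
(* [phi_ j] is the segment of [y] at time 0 and inherits property (A) from it. *)
have phiA : B_nA (phi_ (N := N) (h := h) j).
  apply/property_A_B_nA; have := ysA 0 (lexx _).
  by congr property_A; apply/funext => s; rewrite /seg add0r y0.
(* This is the weak-star equation tested against [coord_dual k]; the term [LE (phi_ j)] vanishes,
   which leaves the constant [e]. *)
have equation s : 0 < s < t ->
    crd (k, b) (xt s) - part (GL s) = e + Rintegral mu `]0, s[ (part \o GR).
  move=> st; have /andP[s0 st'] := st.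
  have := yE s s0 (coord_dual k).
  rewrite (extension_phi0 (N := N) (coord_dual k) HL HLE phiA) subr0.
  rewrite -(seg_cut st) -/xt GLE// /iota /= /phi_ (_ : valI (I0 h) = 0)// eqxx.
  rewrite /ws_integral.
  have -> : cintegral mu `]0, s[ (fun r => RE (seg y r) (coord_dual k)) =
      cintegral mu `]0, s[ GR.
    by congr (_ +i* _); apply: eq_Rintegral => r; rewrite inE/= in_itv/= => rs;
      rewrite -(seg_cut (t := t)) -/xt ?GRE//; lra.
  move=> /(congr1 part); rewrite /part /xt (_ : 0 <= s <= t); last by lra.
  by rewrite /e /crd /=; case: (b); rewrite !raddfD raddfN.
rewrite crdB PE// LP ?t0 ?lexx// /causal_conv t0 /cprim crd_of.
have too := itvoo_lty 0 t.
rewrite -RintegralB//; last 2 first.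
- apply: bmeas_integrable => //; apply: bmeasM => //.
  exact: (bmeas_comp (mr t) (bxt _)).
- apply: bmeas_integrable => //; apply: bmeasM => //.
  exact: (bmeas_comp (mr t) bl).
transitivity (Rintegral mu `]0, t[
  (fun s => qt s * (e + Rintegral mu `]0, t - s[ (part \o GR)))).
  apply: eq_Rintegral => s; rewrite inE/= in_itv/= => st.
  by rewrite -mulrBr -equation//; lra.
rewrite (convolution_primitive _ t0 bqt br) primE; last 2 first.
- move=> s; apply: crd_continuous => r; apply: cvgD; first exact: Lc_cseg_continuous.
  apply/cvg_crdP => c; rewrite crdZ.
  under eq_fun do rewrite crdZ.
  by apply: cvgM; [exact: cq|exact: cvg_cst].
- exact: ltW.
apply: eq_Rintegral => s; rewrite inE/= in_itv/= => st.
rewrite crdD crdZ RP; last by lra.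
rewrite addrC /causal_conv (andP st).1 /qt /= proj_itvE; last by lra.
by rewrite [e * _]mulrC.
Qed.

Lemma column_solution :
  solution L Rop (fun s => (q s)%:C *: (delta_mx j 0 : Cn)) P.
Proof.
have cP := vconv_continuous.
apply: continuous_solution => //; apply: integral_solution column_equation => //.
move=> r; apply/cvg_crdP => c; rewrite crdZ; under eq_fun do rewrite crdZ.
by apply: cvgM; [exact: cq|exact: cvg_cst].
Qed.

End scalar.
End column.

(** * Superposition *)

Section superposition.
Context {R : realType} {n : nat} {N : cnorm R n} {h : {posnum R}}.
Local Notation Cn := (Cn N).
Local Notation C_cn := (contI h Cn).
Local Notation mu := (@lebesgue_measure R).
Context (L Rop : Lc C_cn Cn).

Lemma eq_solution (q q' v : R -> Cn) : (forall t, 0 <= t -> q t = q' t) ->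
  solution L Rop q v -> solution L Rop q' v.
Proof. by move=> qq' [cv v'']; split=> // t t0; rewrite -qq'//; exact: v''. Qed.

Lemma cseg_fun0 t : cseg (fun=> 0) t = 0 :> C_cn.
Proof. by apply: contI_eq => s; rewrite csegE//; exact: cst_continuous. Qed.

Lemma solution0 : solution L Rop (fun=> 0) (fun=> 0).
Proof.
apply: continuous_solution => [|t t0]; first exact: cst_continuous.
rewrite cseg_fun0 linear0 add0r; apply/has_deriv_crdP => c.
have -> : (fun r : R => r^-1 * (crd c ((0 : Cn) - L (cseg (fun=> 0) (t + r)))
    - crd c ((0 : Cn) - L (cseg (fun=> 0) t)))) = fun=> 0.
  by apply/funext => r; rewrite !cseg_fun0 subrr mulr0.
by rewrite crd0; exact: cvg_cst.
Qed.

Lemma solution_sum (J : Type) (r : seq J) (q v : J -> R -> Cn) :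
  (forall i, continuous (v i)) -> (forall i, solution L Rop (q i) (v i)) ->
  continuous (fun t => \sum_(i <- r) v i t) /\
  solution L Rop (fun t => \sum_(i <- r) q i t) (fun t => \sum_(i <- r) v i t).
Proof.
move=> cv sv; elim: r => [|i r [IHc IHs]].
  have E (f : J -> R -> Cn) : (fun t => \sum_(i <- [::]) f i t) = fun=> 0.
    by apply/funext => t; rewrite big_nil.
  by rewrite !E; split; [exact: cst_continuous|exact: solution0].
have E (f : J -> R -> Cn) : (fun t => \sum_(i <- i :: r) f i t) =
    fun t => f i t + \sum_(i <- r) f i t.
  by apply/funext => t; rewrite big_cons.
rewrite !E; split; last exact: solutionD.
by move=> t; apply: cvgD; [exact: cv|exact: IHc].
Qed.

End superposition.

(** * The matrix convolution in real coordinates *)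

Section convolution_formula.
Context {R : realType} {n : nat} {N : cnorm R n}.
Local Notation Cn := (Cn N).
Local Notation mu := (@lebesgue_measure R).
Context (X : R -> 'M[R[i]]_n) (q q' : R -> Cn).
Let x (j : 'I_n) (t : R) : Cn := col j (X t).
Hypotheses (cq' : continuous q') (q'E : forall t, 0 <= t -> q' t = q t).
Hypothesis bx : forall j b c, bmeas ((crd c \o x j) \_ `[0, b]).

(** Column form of the matrix convolution: each complex entry of [q'] is split into its real and
    imaginary parts, so that only real scalar forcings occur. *)
Definition conv_sum (t : R) : Cn :=
  \sum_j (vconv (crd (j, false) \o q') (x j) t
    + 'i *: vconv (crd (j, true) \o q') (x j) t).

Context (t : R) (t0 : 0 < t).

(* Bounded measurable functions on the line that agree on [0, t] with the
   column [x j] and with the coordinates of [q]. *)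
Let xt j (s : R) : Cn := if 0 <= s <= t then x j s else 0.
Let qt c := (crd c \o q') \o proj_itv 0 t.

(** For [0 < s < t] this is the product of the entry [X (t - s) k j] and [q s j 0], multiplied out
    in real coordinates. *)
Let term (k j : 'I_n) (s : R) : R[i] :=
  (qt (j, false) s * crd (k, false) (xt j (t - s))
   - qt (j, true) s * crd (k, true) (xt j (t - s)))
  +i* (qt (j, false) s * crd (k, true) (xt j (t - s))
   + qt (j, true) s * crd (k, false) (xt j (t - s))).

Let termE k s : `]0, t[%classic s ->
  (X (t - s) *m q s) k 0 = \sum_j term k j s.
Proof.
rewrite /= in_itv/= => /andP[s0 st]; rewrite mxE; apply: eq_bigr => j _.
rewrite /term /qt /= proj_itvE ?q'E ?(ltW s0) ?(ltW st)//.
rewrite /xt ifT; last by lra.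
have -> : X (t - s) k j = x j (t - s) k 0 by rewrite /x mxE.
rewrite /crd/=; case: (x j (t - s) k 0) => a b; case: (q s j 0) => a' b'.
by apply/eqP; rewrite eq_complex/=; apply/andP; split; apply/eqP; ring.
Qed.

Let bmeas_factor c c' : bmeas (fun s => qt c s * crd c' (xt c.1 (t - s))).
Proof.
apply: bmeasM.
  by apply: bmeas_proj_itv; [exact: ltW|exact: crd_continuous].
apply: (bmeas_comp (f := fun s => crd c' (xt c.1 s)) (reflect_measurable t)).
rewrite (_ : (fun s => _) = (crd c' \o x c.1) \_ `[0, t]); first exact: bx.
apply/funext => s; rewrite patchE mem_setE in_itv/= /xt.
by case: ifP => // _; rewrite crd0.
Qed.

Let cbmeas_term k j : cbmeas (term k j).
Proof.
split.
- exact: bmeasB (bmeas_factor (j, false) (k, false))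
    (bmeas_factor (j, true) (k, true)).
- exact: bmeasD (bmeas_factor (j, false) (k, true))
    (bmeas_factor (j, true) (k, false)).
Qed.

Let term_sum k := @cintegral_sum _ (measurableTypeR R) R mu _
  (measurable_itv `]0, t[) (itvoo_lty 0 t) _ (index_enum 'I_n) (term k)
  (cbmeas_term k).

Lemma p_fun_vintegrable : vintegrable mu `]0, t[ (fun s => X (t - s) *m q s).
Proof.
move=> k; have [[bre bim] _] := term_sum k.
have too := itvoo_lty 0 t.
by split;
  [apply: eq_integrable (bmeas_integrable _ too bre)|
   apply: eq_integrable (bmeas_integrable _ too bim)] => // s;
  rewrite inE => st /=; rewrite termE.
Qed.

Lemma p_funE : p_fun X q t = conv_sum t.
Proof.
have too := itvoo_lty 0 t.
have vE c c' : crd c' (vconv (crd c \o q') (x c.1) t) =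
    Rintegral mu `]0, t[ (fun s => qt c s * crd c' (xt c.1 (t - s))).
  rewrite /vconv crd_of /causal_conv t0; apply: eq_Rintegral => s.
  rewrite inE/= in_itv/= => /andP[s0 st].
  by rewrite /qt /= proj_itvE ?(ltW s0) ?(ltW st)// /xt ifT//; lra.
rewrite /p_fun t0; apply/matrixP => k l; rewrite (ord1 l) mxE.
transitivity (\sum_j cintegral mu `]0, t[ (term k j)).
  have [_ <-] := term_sum k.
  by congr (_ +i* _); apply: eq_Rintegral => s; rewrite inE => st; rewrite -termE.
rewrite /conv_sum summxE; apply: eq_bigr => j _.
have iC c c' := @bmeas_integrable _ (measurableTypeR R) R mu _ _
  (measurable_itv `]0, t[) too (bmeas_factor c c').
have -> : cintegral mu `]0, t[ (term k j) =
    (crd (k, false) (vconv (crd (j, false) \o q') (x j) t)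
      - crd (k, true) (vconv (crd (j, true) \o q') (x j) t)) +i*
    (crd (k, true) (vconv (crd (j, false) \o q') (x j) t)
      + crd (k, false) (vconv (crd (j, true) \o q') (x j) t)).
  rewrite (vE (j, false)) (vE (j, true)) (vE (j, false)) (vE (j, true)).
  congr (_ +i* _).
    exact: RintegralB (iC (j, false) (k, false)) (iC (j, true) (k, true)).
  exact: RintegralD (iC (j, false) (k, true)) (iC (j, true) (k, false)).
have sE (y z : Cn) : (y + 'i *: z) k 0 = y k 0 + 'i * z k 0 by rewrite !mxE.
rewrite sE /crd/=; set y := vconv (crd (j, false) \o q') (x j) t.
set z := vconv (crd (j, true) \o q') (x j) t.
case: (y k 0) => a b; case: (z k 0) => a' b'.
by apply/eqP; rewrite eq_complex/=; apply/andP; split; apply/eqP; ring.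
Qed.

End convolution_formula.

Theorem corollary6p3 (R : realType) (n : nat) (N : cnorm R n) (h : {posnum R})
    (L Rop : Lc (contI h (Cn N)) (Cn N)) (HL : Delta_cond L)
    (q : R -> Cn N) (Hq : {within `[0, +oo[, continuous q})
    (phi : contI h (Cn N)) :
  exists w : R -> Cn N,
    [/\ solution L Rop q w,
        has_initial w phi,
        forall w' : R -> Cn N,
          solution L Rop q w' -> has_initial w' phi ->
          forall t, - h%:num <= t -> w' t = w t &
        forall (v : R -> Cn N) (X : R -> 'M[R[i]]_n),
          solution L Rop (fun=> 0) v -> has_initial v phi ->
          fundamental_solution L Rop X ->
          (forall t, 0 < t ->
             vintegrable lebesgue_measure `]0, t[ (fun s => X (t - s) *m q s)) /\
          (forall t, - h%:num <= t -> w t = v t + p_fun X q t)].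
Proof.
(* [q] is continuous only on [[0, +oo[]; the constant extension to the left is continuous on the
   line, and the equation only involves times [t >= 0]. *)
pose q' := q \o Num.max 0.
have cq' : continuous q'.
  apply: within_retract_continuous Hq; last exact: maxl_continuous.
  by move=> s; rewrite /= in_itv/= le_max lexx.
have q'E t : 0 <= t -> q' t = q t by move=> t0; rewrite /q' /= max_r.
have [w [cw sw wphi]] := solution_exists Rop phi cq' HL.
have swq := eq_solution q'E sw.
exists w; split=> //.
  move=> w' sw' w'phi; apply: (solution_unique HL sw' swq).
  by move=> s; rewrite w'phi wphi.
move=> v X sv vphi HX.
pose x (j : 'I_n) (t : R) : Cn N := col j (X t).
have xE j : exists2 y, extended_solution L Rop (phi_ j) y &
    x j = fun t => if t < 0 then 0 else y t.
  by have [y Hy yX] := HX j; exists y => //; apply/funext => t; rewrite /x yX.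
have bx j b c : bmeas ((crd c \o x j) \_ `[0, b]).
  by have [y Hy ->] := xE j; exact: column_bmeas Hy b c.
have cqc c : continuous (crd c \o q') by exact: crd_continuous.
split=> [t t0|t ht]; first exact: (p_fun_vintegrable cq' q'E bx t0).
pose V j b := vconv (crd (j, b) \o q') (x j).
have cV j b : continuous (V j b).
  by rewrite /V; have [y Hy ->] := xE j; exact: vconv_continuous Hy _ (cqc _).
have ciV j : continuous (fun t => 'i *: V j true t : Cn N).
  by move=> s; apply: cvgZl_tmp; exact: cV.
have sV j b : solution L Rop
    (fun s => (crd (j, b) (q' s))%:C *: (delta_mx j 0 : Cn N)) (V j b).
  by rewrite /V; have [y Hy ->] := xE j; exact: (column_solution HL Hy (cqc _)).
have sj j := solutionD (cV j false) (ciV j) (sV j false)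
  (solutionZ 'i (cV j true) (sV j true)).
have cj j : continuous (fun t => V j false t + 'i *: V j true t : Cn N).
  by move=> s; apply: cvgD; [exact: cV|exact: ciV].
have [cp sp] := solution_sum (index_enum _) cj sj.
(* [v] may be discontinuous to the left of [-h]; its clamped version is globally continuous, as
   superposition requires. *)
have [cv sv'] := solution_clamp sv.
have p0 (s : R) : s <= 0 -> conv_sum X q' s = 0.
  by move=> s0; rewrite /conv_sum big1// => j _; rewrite !vconv_le0// scaler0 addr0.
(* The forcings given by the real parts, and ['i] times the imaginary parts, of the entries of [q']
   add up to [q'] by [crd_sum]. *)
have svp : solution L Rop q (fun t => clamp (h := h) v t + conv_sum X q' t).
  apply: (eq_solution _ (solutionD cv cp (continuous_solution cv sv') sp)) => s s0.
  by rewrite add0r -q'E// [RHS]crd_sum.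
have -> : p_fun X q t = conv_sum X q' t.
  have [t0|t0] := ltP 0 t; first exact: p_funE.
  by rewrite p0// /p_fun ltNge t0.
rewrite -(clampE (h := h) v ht); apply: (solution_unique HL swq svp) => //.
move=> s; have /andP[hs s0] := valI_itv s.
by rewrite clampE// vphi p0// addr0 wphi.
Qed.
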